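(* Let $H$ be one of the following groups: 1. the alternating group $\mathcal{A}_n$ for large $n$ (i.e. for all $n\ge N$, for some $N\in\mathbb{N}$); 2. $\mathbf{SL}(2,\mathbb{F}_p)$ for a prime $p\ne 2,3,5,17$. Then $H_{[4]}$ admits a mixed Beauville structure.
   Context: For a group $H$ let $\Theta(g,h)=(h,g)$ on $H\times H$. $H_{[4]}=(H\times H)\rtimes\mathbb{Z}/4\mathbb{Z}$, where the generator $1$ of $\mathbb{Z}/4\mathbb{Z}$ acts through $\Theta$. For a finite group $K$ and $a,c\in K$ put $\Sigma(a,c)=\bigcup_{g\in K}\bigcup_{i\ge 0}\{ga^ig^{-1},\,gc^ig^{-1},\,g(ac)^ig^{-1}\}$. A mixed Beauville structure on a nontrivial finite group $G$ is a triple $(G^0;a,c)$, with $G^0\le G$ of index $2$ and $a,c\in G^0$, for which there is $g\in G$ such that: (1) $G^0=\langle a,c\rangle$; (2) $g\notin G^0$; (3) $g\gamma g\gamma\notin\Sigma(a,c)$ for every $\gamma\in G^0$; (4) $\Sigma(a,c)\cap\Sigma(gag^{-1},gcg^{-1})=\{1_G\}$; here $\Sigma$ is formed in $G^0$. *)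

(* Defs.v *)
From HB Require Import structures.
From mathcomp Require Import all_boot all_order all_fingroup all_algebra all_solvable.

Set Implicit Arguments.
Unset Strict Implicit.
Unset Printing Implicit Defensive.

Import GRing.Theory.
Local Open Scope group_scope.

Section Swap4.

Variable H : finGroupType.

Definition Theta (x : H * H) : H * H := (x.2, x.1).

Definition swap4 (x : H * H) (k : 'Z_4) : H * H := iter k Theta x.

Lemma ThetaK : involutive Theta.
Proof. by case. Qed.

Lemma swap4_1 x : swap4 x 1 = x.
Proof. by []. Qed.

Lemma swap4M x (k l : 'Z_4) : swap4 x (k * l) = swap4 (swap4 x k) l.
Proof.
rewrite /swap4 -iterD.
case: k => [[|[|[|[|]]]] //= ?]; case: l => [[|[|[|[|]]]] //= ?];
  by rewrite /= ?ThetaK.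
Qed.

Canonical swap4_action := TotalAction swap4_1 swap4M.

Lemma swap4_is_groupAction : is_groupAction setT swap4_action.
Proof.
move=> k _; rewrite inE; apply/andP; split; first by apply/subsetP=> x; rewrite inE.
apply/morphicP=> x y _ _; rewrite !actpermE /= /swap4.
by elim: (nat_of_ord k) => //= n ->.
Qed.

Canonical swap4_groupAction := GroupAction swap4_is_groupAction.

End Swap4.

(* In sdprod_by the acting group comes first and acts on the right:
   (k, x) * (l, y) = (k + l, Theta^l(x) * y).  As Theta is an involution, this
   is the usual (H * H) ><| Z/4Z with its elements written k * x. *)
Definition H4 (hT : finGroupType) (H : {group hT}) :
    {group sdprod_by (swap4_groupAction (subg_of H))} :=
  [set: sdprod_by (swap4_groupAction (subg_of H))]%G.

Section Beauville.

Variable gT : finGroupType.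
Implicit Types (K G : {group gT}) (a c x g : gT).

(* <[a]> is the set of the a ^+ i for i : nat, and <[a]> :^ g^-1 that of the
   g * a ^+ i * g^-1 ; SigmaP below gives the explicit description. *)
Definition Sigma K a c : {set gT} :=
  \bigcup_(g in K) (<[a]> :|: <[c]> :|: <[a * c]>) :^ g^-1.

Lemma SigmaP K a c x :
  reflect (exists g (i : nat), g \in K /\
             [\/ x = g * a ^+ i * g^-1, x = g * c ^+ i * g^-1
               | x = g * (a * c) ^+ i * g^-1])
          (x \in Sigma K a c).
Proof.
have cJ g y : y ^ g^-1 = g * y * g^-1 by rewrite conjgE invgK mulgA.
apply: (iffP bigcupP) => [[g gK] | [g [i [gK xE]]]].
  case/imsetP=> y + ->; rewrite !inE cJ => /orP[/orP[]|] /cycleP[i ->];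
    exists g, i; split=> //; by [apply: Or31 | apply: Or32 | apply: Or33].
exists g => //; case: xE => ->; rewrite -cJ memJ_conjg !inE mem_cycle ?orbT //.
Qed.

Definition mixed_beauville G (G0 : {group gT}) a c : Prop :=
  [/\ G :!=: 1, G0 \subset G, #|G : G0| = 2, a \in G0 & c \in G0] /\
  exists2 g, g \in G &
    [/\ G0 :=: <<[set a; c]>>,
        g \notin G0,
        forall y, y \in G0 -> g * y * g * y \notin Sigma G0 a c
      & Sigma G0 a c :&: Sigma G0 (g * a * g^-1) (g * c * g^-1) = [set 1]].

Definition admits_mixed_beauville G : Prop :=
  exists (G0 : {group gT}) a c, mixed_beauville G G0 a c.

End Beauville.

Section SL.

Variable p : nat.

Definition SL2 : {set {'GL_2['F_p]}} := [set A | \det (GLval A) == 1]%R.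

Lemma SL2_group_set : group_set SL2.
Proof.
apply/group_setP; split=> [|A B]; first by rewrite inE GL_1E det1.
by rewrite !inE GL_MxE det_mulmx => /eqP-> /eqP->; rewrite mulr1.
Qed.

Canonical SL2_group := Group SL2_group_set.

End SL.

(* Main.v *)
(* Let (a1, c1) and (a2, c2) generate H, with a1, c1 of even order and with the
   orders of a1, c1, a1 c1 prime to those of a2, c2, a2 c2. Then a = (a1, a2, 2),
   c = (c1, c2, 2) and g = (1, 1, 1) give a mixed Beauville structure on H_[4]:
   coprimality leaves only elements (1, 1, k) to worry about in both conditions
   on Sigma, and evenness keeps (1, 1, 2) out of it.

   In Alt_n write n = 4h + 2 + e with 5 <= e <= 8, and L = 4h + 2. The first
   triple consists of an involution and two permutations made of an L-cycle, a
   4-cycle and fixed points; the L-th power of one of these is a double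
   transposition meeting the involution in a single moved point, which yields a
   3-cycle. The second triple consists of three cycles of odd lengths k, l,
   4h + 3 with k + l = 4h + 2 + 2e and k, l prime to 2h + 1. A 3-cycle in a
   transitive group G generates Alt_n with its conjugates as soon as the
   G-invariant relation "equal or moved by a common 3-cycle of G" has one class.

   In SL(2, p) let eps = 1 or -1 with p = eps mod 4. Elements of trace t have order
   dividing p - eps or p + eps according to whether 4 - t^2 is a square. The second
   triple consists of two transvections and an element of the odd order
   (p + eps)/2. The first has orders dividing p - eps and consists of an element c
   of trace t and an element a of trace 0 such that a c^2 or a c^3 is a
   transvection; such t is found among 6/5, 8/5, 14/25 by multiplicativity of
   the quadratic character, unless p = 7, 11, 13, where matrices are given. *)
Require Import Defs.
From mathcomp Require Import all_boot all_order all_fingroup all_algebra all_solvable.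
From mathcomp Require Import all_field.
From mathcomp Require Import zify ring.

Set Implicit Arguments.
Unset Strict Implicit.
Unset Printing Implicit Defensive.

Import GRing.Theory.
Local Open Scope group_scope.

(** * The semidirect product *)

Section EvenPart.

Variable K : finGroupType.
Let G := sdprod_by (swap4_groupAction K).

Definition sd4 (k : 'Z_4) (u v : K) : G :=
  SdPair (swap4_groupAction K) (introT setXP (conj (in_setT k) (in_setT (u, v)))).

Lemma sd4P (x : G) : exists k u v, x = sd4 k u v.
Proof. by case: x => [[k [u v]] xP]; exists k, u, v; apply: val_inj. Qed.

Lemma sd4M k u v l u' v' :
  sd4 k u v * sd4 l u' v' =
  if odd l then sd4 (k * l) (v * u') (u * v') else sd4 (k * l) (u * u') (v * v').
Proof.
by apply: val_inj; case: l => [[|[|[|[|]]]] //= l4] /=; congr (_, _).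
Qed.

(** The elements with component 0 or 2 in Z/4. These components act trivially, so such elements form
    a direct product K x K x Z/2 with [b] as last coordinate; it will be G0. *)
Definition even_elt (b : bool) := sd4 (if b then 2%R else 0%R).

Lemma even_eltM b u v b' u' v' :
  even_elt b u v * even_elt b' u' v' = even_elt (b (+) b') (u * u') (v * v').
Proof.
by rewrite sd4M; case: b b' => [] [] //=; congr sd4; apply: val_inj.
Qed.

Lemma even_elt1 : even_elt false 1 1 = 1.
Proof. exact: val_inj. Qed.

Lemma even_eltX b u v i :
  even_elt b u v ^+ i = even_elt (b && odd i) (u ^+ i) (v ^+ i).
Proof.
elim: i => [|i IHi]; first by rewrite andbF even_elt1.
by rewrite !expgS IHi even_eltM /=; case: b {IHi} => //=; case: odd.
Qed.

Lemma even_eltV b u v : (even_elt b u v)^-1 = even_elt b u^-1 v^-1.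
Proof. by apply: mulg1_eq; rewrite even_eltM addbb !mulgV even_elt1. Qed.

Lemma even_elt_inj b u v b' u' v' :
  even_elt b u v = even_elt b' u' v' -> [/\ b = b', u = u' & v = v'].
Proof.
move=> eq_uv.
have [eq_k eq_u eq_v] : [/\ (if b then 2%R else 0%R) = (if b' then 2%R else 0%R) :> 'Z_4, u = u' & v = v'].
  have := congr1 (fun x : G => (pair_of_sd x).1) eq_uv.
  have := congr1 (fun x : G => (pair_of_sd x).2.1) eq_uv.
  by have := congr1 (fun x : G => (pair_of_sd x).2.2) eq_uv.
by split=> //; case: b b' eq_k {eq_uv} => [] [].
Qed.

Definition swap_elt := sd4 1%R 1 1.

Lemma swap_eltV : swap_elt^-1 = sd4 (-1)%R 1 1.
Proof.
apply: mulg1_eq; apply: val_inj; rewrite /= !mulg1.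
by congr pair; apply: val_inj.
Qed.

Lemma even_eltJ b u v : swap_elt * even_elt b u v * swap_elt^-1 = even_elt b v u.
Proof.
rewrite swap_eltV /even_elt /swap_elt; case: b; rewrite !sd4M /= !(mulg1, mul1g).
  by congr sd4; apply: val_inj.
by congr sd4; apply: val_inj.
Qed.

(** An element outside the even part has component 1 or 3, and twice either is 2, so its square
    never has component 0. This is the point of Z/4 as opposed to Z/2. *)
Lemma swap_even_sq b u v :
  swap_elt * even_elt b u v * swap_elt * even_elt b u v = even_elt true (v * u) (u * v).
Proof.
rewrite /even_elt /swap_elt; case: b; rewrite !sd4M /= !(mulg1, mul1g).
  by congr sd4; apply: val_inj.
by congr sd4; apply: val_inj.
Qed.

Lemma even_or_swap (x : G) :
  exists b u v, x = even_elt b u v \/ x = even_elt b u v * swap_elt.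
Proof.
have [k [u [v ->]]] := sd4P x; case: k => [[|[|[|[|]]]] //= k4].
- by exists false, u, v; left; congr sd4; apply: val_inj.
- exists false, v, u; right; rewrite sd4M /= !mulg1.
  by congr sd4; apply: val_inj.
- by exists true, u, v; left; congr sd4; apply: val_inj.
- exists true, v, u; right; rewrite sd4M /= !mulg1.
  by congr sd4; apply: val_inj.
Qed.

Lemma even_swap_neq b u v b' u' v' : even_elt b u v * swap_elt <> even_elt b' u' v'.
Proof.
rewrite sd4M /= => /(congr1 (fun x : G => odd x.1)) /=.
by case: b b' => [] [].
Qed.

End EvenPart.

(** The squares in the generation hypothesis come from the third coordinate: a1 and c1 both enter
    with component 2, so only words of even length in them have component 0. *)
Lemma mixed_beauville_of_pairs (K : finGroupType) (a1 c1 a2 c2 : K) n1 n2 :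
    coprime n1 n2 -> ~~ odd #[a1] -> ~~ odd #[c1] ->
    [/\ a1 ^+ n1 = 1, c1 ^+ n1 = 1 & (a1 * c1) ^+ n1 = 1] ->
    [/\ a2 ^+ n2 = 1, c2 ^+ n2 = 1 & (a2 * c2) ^+ n2 = 1] ->
    <<[set a1 ^+ 2; a1 * c1; c1 ^+ 2]>> = [set: K] -> <<[set a2; c2]>> = [set: K] ->
  admits_mixed_beauville [set: sdprod_by (swap4_groupAction K)]%G.
Proof.
move=> co_n even_a even_c [a1n c1n ac1n] [a2n c2n ac2n] gen1 gen2.
have even_n1 : ~~ odd n1.
  apply: contra even_a => odd_n1; apply: dvdn_odd odd_n1.
  by rewrite order_dvdn a1n.
pose a := even_elt true a1 a2; pose c := even_elt true c1 c2.
have acE : a * c = even_elt false (a1 * c1) (a2 * c2) by rewrite even_eltM.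
pose G0 := <<[set a; c]>>%G.
have aG : a \in G0 by rewrite mem_gen // !inE eqxx.
have cG : c \in G0 by rewrite mem_gen // !inE eqxx orbT.
(* An exponent that is 1 modulo n1 and 0 modulo n2 isolates the first coordinate, and one with the
   residues exchanged the second. As n1 is even, the residue modulo n1 also fixes the parity, hence
   the component in Z/4. *)
have split_coords u v : u ^+ n1 = 1 -> v ^+ n2 = 1 -> even_elt true u v \in G0 ->
    even_elt true u 1 \in G0 /\ even_elt false 1 v \in G0.
  move=> un vn uvG.
  have X (w : K) k l : w ^+ l = 1 -> w ^+ k = w ^+ (k %% l).
    by move=> wl; rewrite {1}(divn_eq k l) expgD mulnC expgM wl expg1n mul1g.
  have odd_n k : odd k = odd (k %% n1).
    by rewrite {1}(divn_eq k n1) oddD oddM (negbTE even_n1) andbF.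
  split.
    have := groupX (chinese n1 n2 1 0) uvG; rewrite even_eltX andTb.
    rewrite (odd_n (chinese _ _ _ _)) (X u _ _ un) (X v _ _ vn) chinese_modl // chinese_modr //.
    by rewrite -odd_n -!X // expg0 expg1.
  have := groupX (chinese n1 n2 0 1) uvG; rewrite even_eltX andTb.
  rewrite (odd_n (chinese _ _ _ _)) (X u _ _ un) (X v _ _ vn) chinese_modl // chinese_modr //.
  by rewrite -odd_n -!X // expg0 expg1.
have [a1G a2G] := split_coords _ _ a1n a2n aG.
have [c1G c2G] := split_coords _ _ c1n c2n cG.
have sndG v : even_elt false 1 v \in G0.
  have: v \in <<[set a2; c2]>> by rewrite gen2 inE.
  pose V := [set v : K | even_elt false 1 v \in G0].
  have grV : group_set V.
    apply/group_setP; split=> [|x y]; first by rewrite inE even_elt1 group1.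
    by rewrite !inE => xG yG; have := groupM xG yG; rewrite even_eltM mulg1.
  suffices: <<[set a2; c2]>> \subset Group grV by move/subsetP=> sV /sV; rewrite inE.
  by rewrite gen_subG; apply/subsetP=> x /set2P[] ->; rewrite inE.
have fstG u : even_elt false u 1 \in G0.
  have: u \in <<[set a1 ^+ 2; a1 * c1; c1 ^+ 2]>> by rewrite gen1 inE.
  pose V := [set v : K | even_elt false v 1 \in G0].
  have grV : group_set V.
    apply/group_setP; split=> [|x y]; first by rewrite inE even_elt1 group1.
    by rewrite !inE => xG yG; have := groupM xG yG; rewrite even_eltM mulg1.
  suffices: <<[set a1 ^+ 2; a1 * c1; c1 ^+ 2]>> \subset Group grV.
    by move/subsetP=> sV /sV; rewrite inE.
  rewrite gen_subG; apply/subsetP=> x; rewrite !inE.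
  have EM y z : even_elt true y 1 * even_elt true z 1 = even_elt false (y * z) 1.
    by rewrite even_eltM mulg1.
  by case/orP=> [/orP[]|] /eqP->; rewrite ?expg2 -EM groupM.
have EG b u v : even_elt b u v \in G0.
  (* Dividing (a1, 1, 2) by (a1, 1, 0) leaves (1, 1, 2). *)
  have tG : even_elt true 1 1 \in G0.
    by have := groupM a1G (fstG a1^-1); rewrite even_eltM mulgV mulg1.
  have := groupM (groupM (fstG u) (sndG v)) (groupX b tG).
  by rewrite even_eltX !even_eltM !expg1n !(mulg1, mul1g); case: b.
have GE x : x \in G0 -> exists b u v, x = even_elt b u v.
  pose V := [set x in codom (fun y : bool * K * K => even_elt y.1.1 y.1.2 y.2)].
  have VP y : reflect (exists b u v, y = even_elt b u v) (y \in V).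
    rewrite inE; apply: (iffP codomP) => [[[[b u] v] ->]|[b [u [v ->]]]].
      by exists b, u, v.
    by exists (b, u, v).
  have grV : group_set V.
    apply/group_setP; split; first by apply/VP; exists false, 1, 1; rewrite even_elt1.
    move=> y z /VP[b [u [v ->]]] /VP[b' [u' [v' ->]]]; rewrite even_eltM.
    by apply/VP; do 3 eexists.
  suffices: G0 \subset Group grV by move/subsetP=> sV /sV/VP.
  by rewrite gen_subG; apply/subsetP=> y /set2P[] ->; apply/VP; do 3 eexists.
pose g := swap_elt K.
have gG : g \notin G0.
  apply/negP=> /GE[b [u [v]]]; rewrite -[g]mul1g -even_elt1.
  exact: even_swap_neq.
have a1X i : odd i -> a1 ^+ i != 1.
  by move=> odd_i; apply: contra even_a; rewrite -order_dvdn => /dvdn_odd->.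
have c1X i : odd i -> c1 ^+ i != 1.
  by move=> odd_i; apply: contra even_c; rewrite -order_dvdn => /dvdn_odd->.
have Xn (w : K) k i : w ^+ k = 1 -> (w ^+ i) ^+ k = 1.
  by move=> wk; rewrite -expgM mulnC expgM wk expg1n.
(* The invariant of Sigma. Component 2 arises only from odd powers of a or c, since a c has
   component 0; such powers have a nontrivial first coordinate because a1 and c1 have even order. *)
pose good b (u v : K) := [/\ u ^+ n1 = 1, v ^+ n2 = 1 & b -> u != 1].
have goodJ b u v y z : good b u v -> good b (y * u * y^-1) (z * v * z^-1).
  have cJ (s t : K) : s * t * s^-1 = t ^ s^-1 by rewrite conjgE invgK mulgA.
  rewrite !cJ => -[un vn bu]; split; rewrite -?conjXg ?un ?vn ?conj1g //.
  by rewrite conjg_eq1.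
have EJ b u v b' u' v' : even_elt b' u' v' * even_elt b u v * (even_elt b' u' v')^-1
    = even_elt b (u' * u * u'^-1) (v' * v * v'^-1).
  by rewrite even_eltV !even_eltM addbC addbA addbb.
have SigmaG b u v : even_elt b u v \in Sigma G0 a c -> good b u v.
  case/SigmaP=> h [i [/GE[b' [u' [v' ->]]]]].
  rewrite acE !even_eltX !EJ /=.
  case=> /even_elt_inj[-> -> ->]; apply: goodJ; split; rewrite ?Xn //.
  - exact: a1X.
  - exact: c1X.
have SigmaG' b u v : even_elt b u v \in Sigma G0 (g * a * g^-1) (g * c * g^-1) -> good b v u.
  case/SigmaP=> h [i [/GE[b' [u' [v' ->]]]]].
  rewrite !even_eltJ even_eltM !even_eltX !EJ /=.
  case=> /even_elt_inj[-> -> ->]; apply: goodJ; split; rewrite ?Xn //.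
  - exact: a1X.
  - exact: c1X.
have coprime_eq1 (u : K) : u ^+ n1 = 1 -> u ^+ n2 = 1 -> u = 1.
  move=> un1 un2; apply/eqP; rewrite -order_eq1 -dvdn1 -(eqP co_n).
  by rewrite dvdn_gcd !order_dvdn un1 un2 eqxx.
exists G0, a, c; split.
  split=> //; last 1 first.
  - have GU : [set: sdprod_by (swap4_groupAction K)] = G0 :|: G0 :* g.
      apply/setP=> x; rewrite !inE; have [b [u [v [->|->]]]] := even_or_swap x.
        by rewrite EG.
      by rewrite orbC (introT rcosetP) //; exists (even_elt b u v); rewrite ?EG.
    have cardG : #|[set: sdprod_by (swap4_groupAction K)]| = (2 * #|G0|)%N.
      rewrite GU cardsU card_rcoset (_ : _ :&: _ = set0) ?cards0 ?subn0 ?addnn ?mul2n //.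
      apply/setP=> x; rewrite !inE; apply/negP=> /andP[xG /rcosetP[y yG xE]].
      by case/negP: gG; rewrite -(groupMl g yG) -xE.
    by rewrite -divgS ?subsetT // cardG mulnK ?cardG_gt0.
  - apply/eqP=> /setP/(_ g); rewrite inE in_set1 => /esym/eqP g1.
    by move: gG; rewrite g1 group1.
  - exact: subsetT.
exists g; first by rewrite inE.
split=> //.
  (* The coordinates v u and u v are conjugate, so membership in Sigma would make v u killed by both
     n1 and n2, hence trivial, against the last clause of [good]. *)
  move=> y /GE[b [u [v ->]]]; rewrite swap_even_sq; apply/negP=> /SigmaG[vu_n uv_n].
  case/(_ isT)/eqP; apply: coprime_eq1 => //.
  have -> : v * u = (u * v) ^ u by rewrite conjgE !mulgA mulVg mul1g.
  by rewrite -conjXg uv_n conj1g.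
apply/setP=> x; rewrite !inE; apply/andP/eqP=> [[]|->]; last first.
  by split; apply/SigmaP; exists 1, 0; rewrite group1 mulg1 mul1g invg1; split=> //; constructor 1.
move=> xS; have [b [u [v xE]]] : exists b u v, x = even_elt b u v.
  apply: GE; case/SigmaP: xS => h [i [hG xE]].
  by case: xE => ->; rewrite groupMr ?groupMl ?groupV ?groupX // groupM.
move: xS; rewrite xE => /SigmaG[un1 vn2 bu] /SigmaG'[vn1 un2 bv].
have u1 := coprime_eq1 u un1 un2; have v1 := coprime_eq1 v vn1 vn2.
rewrite u1 v1; case: b bu {xE bv} => [/(_ isT)|_]; first by rewrite u1 eqxx.
exact: even_elt1.
Qed.

(** The group N generated by a^2, a c, c^2 also contains c a and is normalized by a. Modulo N the
    group is generated by a, whose square is trivial, so N contains x^2 and with it x, a power of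
    x^2. *)
Lemma gen_sqr_sub_gen (gT : finGroupType) (a c x : gT) :
  x \in <<[set a; c]>> -> odd #[x] -> x \in <<[set a ^+ 2; a * c; c ^+ 2]>>.
Proof.
move=> xG odd_x; pose N := <<[set a ^+ 2; a * c; c ^+ 2]%g>>%G; rewrite -[_ \in _]/(x \in N).
have aN : a ^+ 2 \in N by rewrite mem_gen // !inE eqxx.
have acN : a * c \in N by rewrite mem_gen // !inE eqxx orbT.
have cN : c ^+ 2 \in N by rewrite mem_gen // !inE eqxx orbT.
have caN : c * a \in N.
  suffices -> : c * a = c ^+ 2 * (a * c)^-1 * a ^+ 2.
    by rewrite groupM // groupM // groupV.
  by rewrite invMg !expg2 !mulgA mulgK mulgVK.
have normN : a \in 'N(N).
  apply/normP/eqP; rewrite eqEcard cardJg leqnn andbT -genJ gen_subG.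
  apply/subsetP=> y /imsetP[z + ->]; rewrite !inE => /orP[/orP[]|] /eqP->.
  - by rewrite conjXg conjgE mulKg.
  - by rewrite conjgE mulgA mulKg.
  - have -> : (c ^+ 2) ^ a = (a ^+ 2)^-1 * (a * c) * (c * a).
      by rewrite conjgE !expg2 invMg !mulgA mulgVK.
    by rewrite groupM // groupM // groupV.
have : x \in N * <[a]>.
  rewrite -norm_joinEr ?cycle_subG //.
  apply: subsetP xG; rewrite gen_subG; apply/subsetP=> y /set2P[] ->.
    by rewrite mem_gen // !inE cycle_id orbT.
  rewrite -(mulKg a c) groupM ?groupV ?mem_gen // !inE ?cycle_id ?orbT //.
  by rewrite acN.
case/mulsgP=> y _ yN /cycleP[i ->] x_def.
have x2N : x ^+ 2 \in N.
  have -> : x ^+ 2 = y * (y ^ (a ^- i)) * (a ^+ 2) ^+ i.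
    rewrite x_def expg2 conjgE invgK -expgM mul2n -addnn expgD !mulgA.
    by rewrite mulgVK.
  apply: groupM; last by rewrite groupX.
  by apply: groupM => //; rewrite memJ_norm // groupV groupX.
have -> : x = (x ^+ 2) ^+ uphalf #[x].
  by rewrite -expgM mul2n uphalfE halfK /= odd_x /= subn0 expgS expg_order mulg1.
exact: groupX.
Qed.

(** Transport to the type [subg_of H]. The last hypothesis, that elements of odd order generate H,
    replaces the generation by squares. *)
Lemma H4_mixed_beauville (gT : finGroupType) (H : {group gT}) (a1 c1 a2 c2 : gT) n1 n2 :
    coprime n1 n2 -> ~~ odd #[a1] -> ~~ odd #[c1] ->
    [/\ a1 ^+ n1 = 1, c1 ^+ n1 = 1 & (a1 * c1) ^+ n1 = 1] ->
    [/\ a2 ^+ n2 = 1, c2 ^+ n2 = 1 & (a2 * c2) ^+ n2 = 1] ->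
    <<[set a1; c1]>> = H -> <<[set a2; c2]>> = H ->
    H \subset <<[set x in H | odd #[x]]>> ->
  admits_mixed_beauville (H4 H).
Proof.
move=> co_n even_a even_c [a1n c1n ac1n] [a2n c2n ac2n] gen1 gen2 oddH.
have gen1' : <<[set a1 ^+ 2; a1 * c1; c1 ^+ 2]>> = H.
  have [a1H c1H] : a1 \in H /\ c1 \in H by rewrite -gen1 !mem_gen // !inE eqxx ?orbT.
  apply/eqP; rewrite eqEsubset gen_subG; apply/andP; split.
    by apply/subsetP=> x; rewrite !inE => /orP[/orP[]|] /eqP->; rewrite ?groupX ?groupM.
  apply: subset_trans oddH _; rewrite gen_subG; apply/subsetP=> x.
  by rewrite inE -{1}gen1 => /andP[]; exact: gen_sqr_sub_gen.
have [a1H c1H] : a1 \in H /\ c1 \in H by rewrite -gen1 !mem_gen // !inE eqxx ?orbT.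
have [a2H c2H] : a2 \in H /\ c2 \in H by rewrite -gen2 !mem_gen // !inE eqxx ?orbT.
have genT (A : {set gT}) : A \subset H -> <<A>> = H -> <<subg H @* A>> = [set: subg_of H].
  by move=> sAH defH; rewrite -morphim_gen // defH im_subg.
have orderS x : x \in H -> #[subg H x] = #[x] by move=> xH; rewrite order_injm ?injm_subg.
have XS x n : x \in H -> x ^+ n = 1 -> subg H x ^+ n = 1.
  by move=> xH xn; rewrite -morphX // xn morph1.
apply: (@mixed_beauville_of_pairs _ (subg H a1) (subg H c1) (subg H a2) (subg H c2) n1 n2).
- by [].
- by rewrite orderS.
- by rewrite orderS.
- by rewrite -morphM // !XS // groupM.
- by rewrite -morphM // !XS // groupM.
- rewrite -!morphX // -morphM // -!morphim_set1 ?groupX ?groupM // -!morphimU.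
  apply: genT => //.
  by apply/subsetP=> x; rewrite !inE => /orP[/orP[]|] /eqP->; rewrite ?groupX ?groupM.
- rewrite -!morphim_set1 // -morphimU; apply: genT => //.
  by apply/subsetP=> x; rewrite !inE => /orP[] /eqP->.
Qed.

(** * Alternating groups *)

Section ThreeCycles.

Variable T : finType.
Implicit Types (G : {group {perm T}}) (s : {perm T}) (x y z : T).

(** The transpositions through p generate the symmetric group. Trivial factors are dropped so that
    the length of the list gives the parity of s. *)
Lemma prod_star_tperm (p : T) s :
  exists2 l : seq T, p \notin l & s = \prod_(q <- l) tperm p q.
Proof.
have: s \in <<[set tperm p y | y : T]>> by rewrite gen_tperm inE.
case/gen_prodgP=> n [c cP ->].
have cE i : c i = tperm p (c i p) by have /imsetP[y _ ->] := cP i; rewrite tpermL.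
exists [seq q <- [seq c i p | i <- index_enum 'I_n] | q != p].
  by rewrite mem_filter eqxx.
rewrite big_filter [RHS]big_mkcond big_map; apply: eq_bigr => i _.
case: ifP => [_ | /negbFE/eqP cp]; first exact: cE.
by rewrite cE cp tperm1.
Qed.

(* The 3-cycle x -> y -> z -> x. *)
Definition cyc3 x y z := tperm x y * tperm x z.

Lemma cyc3J x y z s : cyc3 x y z ^ s = cyc3 (s x) (s y) (s z).
Proof. by rewrite conjMg !tpermJ. Qed.

Lemma cyc3V x y z : (cyc3 x y z)^-1 = cyc3 x z y.
Proof. by rewrite invMg !tpermV. Qed.

Lemma cyc3_rot x y z : y != x -> z != x -> z != y -> cyc3 x y z = cyc3 y z x.
Proof.
move=> yx zx zy; rewrite /cyc3 (tpermC y x).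
have -> : tperm y z = tperm x z ^ tperm x y by rewrite tpermJ tpermL tpermD // eq_sym.
by rewrite conjgE tpermV -!mulgA tperm2 mulg1.
Qed.

Lemma cyc3E x y z : y != x -> z != x -> z != y ->
  [/\ cyc3 x y z x = y, cyc3 x y z y = z, cyc3 x y z z = x
    & forall t, t != x -> t != y -> t != z -> cyc3 x y z t = t].
Proof.
move=> yx zx zy; split=> [|||t tx ty tz].
- by rewrite permM tpermL tpermD // eq_sym.
- by rewrite permM tpermR tpermL.
- by rewrite permM (tpermD (z := z)) 1?eq_sym // tpermR.
- by rewrite permM !tpermD // eq_sym.
Qed.

(** An even permutation is a product of an even number of transpositions through p, and two
    consecutive factors [tperm p x * tperm p y] give 1 or [cyc3 p x y]. *)
Lemma Alt_sub_star (p : T) G :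
    (forall x y, x != p -> y != p -> y != x -> cyc3 p x y \in G) ->
  'Alt_T \subset G.
Proof.
move=> starG; apply/subsetP=> s; rewrite Alt_even.
have [l pl ->] := prod_star_tperm p s.
have [n] := ubnP (size l); elim: n l pl => // n IHn [|x [|y l]] /=.
- by rewrite big_nil group1.
- by rewrite inE => /negbTE neq; rewrite big_seq1 odd_tperm neq.
rewrite !inE !negb_or => /and3P[px py pl] lt_n.
rewrite !big_cons mulgA !odd_permM !odd_tperm px py addbb addFb => even_l.
rewrite groupM ?IHn // 1?ltnW //.
have [->|neq_xy] := eqVneq x y; first by rewrite tperm2 group1.
by apply: starG; rewrite // eq_sym.
Qed.

(** Conjugating (p q s) by (p r s) gives (r q p), the inverse of (p q r). *)
Lemma cyc3_share2 G (p q r s : T) : q != p -> r != p -> s != p -> r != q -> s != q -> s != r ->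
  cyc3 p q s \in G -> cyc3 p r s \in G -> cyc3 p q r \in G.
Proof.
move=> qp rp sp rq sq sr qG rG.
have [Ep Er Es out] := cyc3E rp sp sr.
have := groupJ qG rG; rewrite cyc3J Ep Es out // 1?eq_sym // => rqp.
by rewrite -cyc3V groupV cyc3_rot // eq_sym.
Qed.

(** When s and s' are distinct and differ from q and r, conjugating (p q s) by (p r s') gives (r q
    s); two uses of [cyc3_share2] then produce (s p r) and (p q r). The coincidences are treated
    first. *)
Lemma cyc3_share1 G (p q r s s' : T) :
    q != p -> r != p -> s != p -> s' != p -> r != q -> s != q -> s' != r ->
  cyc3 p q s \in G -> cyc3 p r s' \in G -> cyc3 p q r \in G.
Proof.
move=> qp rp sp s'p rq sq s'r qG rG.
have [->//|sr] := eqVneq r s.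
have [eqs|s'q] := eqVneq s' q; first by rewrite -cyc3V groupV -eqs.
have [eqs|s's] := eqVneq s' s.
  by apply: (@cyc3_share2 _ _ _ _ s); rewrite // 1?eq_sym // -eqs.
have [Ep Er Es' out] := cyc3E rp s'p s'r.
have rqG : cyc3 r q s \in G.
  by have := groupJ qG rG; rewrite cyc3J Ep !out // eq_sym.
apply: (@cyc3_share2 _ _ _ _ s) => //; rewrite 1?eq_sym //.
rewrite -(@cyc3_rot s p r) // 1?eq_sym //.
apply: (@cyc3_share2 _ _ _ _ q) => //; rewrite 1?eq_sym //.
  by rewrite cyc3_rot // eq_sym.
by rewrite cyc3_rot // eq_sym.
Qed.

(** Fixing the orientation of the 3-cycle loses nothing: the opposite one is its inverse. *)
Definition linked G x y :=
  (x == y) || [exists z, [&& y != x, z != x, z != y & cyc3 x y z \in G]].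

Lemma linkedP G x y :
  reflect (x = y \/ exists z, [/\ y != x, z != x, z != y & cyc3 x y z \in G]) (linked G x y).
Proof.
apply: (iffP orP) => [[/eqP|/existsP[z /and4P[? ? ? ?]]]|[->|[z [? ? ? ?]]]].
- by left.
- by right; exists z.
- by left.
- by right; apply/existsP; exists z; apply/and4P.
Qed.

Lemma linked_sym G x y : linked G x y -> linked G y x.
Proof.
case/linkedP=> [->|[z [yx zx zy zG]]]; apply/linkedP; [by left | right].
exists z; split; rewrite // 1?eq_sym //.
by rewrite -cyc3V groupV -cyc3_rot.
Qed.

Lemma linked_trans G x y z : linked G x y -> linked G y z -> linked G x z.
Proof.
move/linked_sym=> /linkedP[->//|[s [xy sy sx sG]]].
case/linkedP=> [<-|[t [zy ty tz tG]]].
  by apply: linked_sym; apply/linkedP; right; exists s.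
have [->|zx] := eqVneq x z; first by rewrite /linked eqxx.
apply/linkedP; right; exists y; split=> //; rewrite 1?eq_sym //.
by rewrite -cyc3_rot // 1?eq_sym //; apply: cyc3_share1 sG tG; rewrite // eq_sym.
Qed.

Lemma linkedJ G s x y : s \in G -> linked G x y -> linked G (s x) (s y).
Proof.
move=> sG /linkedP[->|[z [yx zx zy zG]]]; apply/linkedP; [by left | right].
by exists (s z); rewrite !(inj_eq perm_inj) -cyc3J groupJ.
Qed.

Lemma cyc3_linked G x y z : y != x -> z != x -> z != y -> cyc3 x y z \in G ->
  [/\ linked G x y, linked G x z & linked G y z].
Proof.
move=> yx zx zy G3.
have xy : linked G x y by apply/linkedP; right; exists z.
have yz : linked G y z.
  by apply/linkedP; right; exists x; rewrite -cyc3_rot // ![x == _]eq_sym.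
by split=> //; apply: linked_trans yz.
Qed.

(** A 3-cycle moving p and x and one moving p and y combine into [cyc3 p x y] by [cyc3_share1], so
    [Alt_sub_star] applies. *)
Lemma Alt_sub_linked (p : T) G : (forall x, linked G p x) -> 'Alt_T \subset G.
Proof.
move=> pG; apply: (@Alt_sub_star p) => x y xp yp yx.
case/linkedP: (pG x) xp => [->|[s [xp sp sx sG]] _]; first by rewrite eqxx.
case/linkedP: (pG y) yp => [->|[t [yp tp ty tG]] _]; first by rewrite eqxx.
exact: cyc3_share1 sG tG.
Qed.

(* Being linked is invariant under G, so a class that s does not move off itself is stable under s. *)
Lemma linked_stable G s (p q : T) :
    s \in G -> linked G p q -> linked G p (s q) ->
  forall x, linked G p x -> linked G p (s x).
Proof.
move=> sG pq psq x px; apply: linked_trans psq _.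
by apply: linkedJ => //; apply: linked_trans px; apply: linked_sym.
Qed.

End ThreeCycles.

(** Duplicate-freeness and membership for rearranged lists are reduced to comparing counts of an
    arbitrary predicate; its values become unknown naturals for [lia]. *)
Ltac lia_counts :=
  repeat match goal with |- context [nat_of_bool ?b] => move: (nat_of_bool b) => ? end; lia.

(** * Cycles given by lists of points, and the pair of odd cycles *)

Section Cycles.

Variable T : finType.
Implicit Types (G : {group {perm T}}) (c d : {perm T}) (x y z : T) (s : seq T).

(* The cycle x -> s_0 -> s_1 -> ... -> x. *)
Definition cyc x s : {perm T} := \prod_(y <- s) tperm x y.

Lemma cyc_cons x y s : cyc x (y :: s) = tperm x y * cyc x s.
Proof. exact: big_cons. Qed.

Lemma cyc_cat x s s' : cyc x (s ++ s') = cyc x s * cyc x s'.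
Proof. exact: big_cat. Qed.

Lemma cyc_rev x s : cyc x (rev s) = (cyc x s)^-1.
Proof.
elim: s => [|y s IHs]; first by rewrite /cyc !big_nil invg1.
by rewrite rev_cons -cats1 cyc_cat IHs /cyc big_seq1 big_cons invMg tpermV.
Qed.

Lemma cyc_out x s y : y \notin x :: s -> cyc x s y = y.
Proof.
rewrite inE negb_or => /andP[yx]; elim: s => [|z s IHs]; first by rewrite /cyc big_nil perm1.
rewrite inE negb_or => /andP[yz ys]; rewrite cyc_cons permM tpermD 1?eq_sym //.
exact: IHs.
Qed.

Lemma perm_on_cyc x s : perm_on [set y in x :: s] (cyc x s).
Proof. by apply/subsetP=> y; rewrite !inE; apply: contraR => ys; rewrite cyc_out // inE. Qed.

Lemma cycJ x s d : cyc x s ^ d = cyc (d x) (map d s).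
Proof.
by rewrite /cyc big_map; elim: s => [|y s IHs]; rewrite ?big_nil ?conj1g // !big_cons conjMg IHs tpermJ.
Qed.

Lemma cyc_head x s : uniq (x :: s) -> cyc x s x = head x s.
Proof.
case: s => [|y s] /=; first by rewrite /cyc big_nil perm1.
rewrite inE negb_or => /andP[/andP[xy xs] /andP[ys _]].
by rewrite cyc_cons permM tpermL cyc_out // inE negb_or eq_sym xy.
Qed.

(** At [i = size s] the default value x of [nth] closes the cycle. *)
Lemma cyc_nth x s i : uniq (x :: s) -> i <= size s ->
  cyc x s (nth x (x :: s) i) = nth x s i.
Proof.
case: i => [|i] Us lt_i; first by rewrite /= cyc_head // nth0.
rewrite /= -{1}(cat_take_drop i s) (drop_nth x) // cyc_cat permM.
have := Us; rewrite -{1}(cat_take_drop i s) (drop_nth x) //.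
set y := nth x s i; set A := take i s; set B := drop i.+1 s.
rewrite /= mem_cat cat_uniq !inE !negb_or /=.
case/and3P=> [/and3P[xA xy xB] _ /and3P[/andP[yA _] yB UB]].
rewrite (@cyc_out x A); last by rewrite inE negb_or eq_sym xy.
by rewrite cyc_cons permM tpermR cyc_head /= ?xB ?UB // -nth0 nth_drop addn0.
Qed.

Lemma cyc_fcycle x s : uniq (x :: s) -> fcycle (cyc x s) (x :: s).
Proof.
move=> Us; apply/(pathP x) => i; rewrite size_rcons ltnS => le_i /=.
rewrite !nth_rcons -rcons_cons nth_rcons /= ltnS le_i cyc_nth //.
by case: ltngtP le_i => // -> _; rewrite nth_default.
Qed.

Lemma fcycle_iter d s y : fcycle d s -> uniq s -> y \in s -> (d ^+ size s) y = y.
Proof.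
move=> fc Us ys; rewrite permX -(order_cycle fc Us ys).
by apply: iter_order; apply: perm_inj.
Qed.

Lemma cyc_order x s : uniq (x :: s) -> cyc x s ^+ (size s).+1 = 1.
Proof.
move=> Us; apply/permP=> y; rewrite perm1.
have [ys|ys] := boolP (y \in x :: s).
  exact: (fcycle_iter (cyc_fcycle Us) Us ys).
by apply: permX_fix; apply: cyc_out.
Qed.

Lemma odd_cyc x s : uniq (x :: s) -> odd_perm (cyc x s) = odd (size s).
Proof.
case/andP=> xs _; elim: s xs => [|y s IHs]; first by rewrite /cyc big_nil odd_perm1.
by rewrite inE negb_or cyc_cons odd_mul_tperm => /andP[-> /IHs->].
Qed.

Lemma cyc_comm x s y t : uniq (x :: s ++ y :: t) -> commute (cyc x s) (cyc y t).
Proof.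
rewrite -cat_cons cat_uniq => /and3P[_ /hasPn dis _].
apply: perm_onC (perm_on_cyc _ _) (perm_on_cyc _ _) _.
by rewrite disjoint_sym disjoint_subset; apply/subsetP=> z; rewrite !inE => /dis; rewrite inE.
Qed.

(** The cycle is [cyc x A * tperm x y * cyc x B], and conjugation by [tperm x y] turns its first
    factor into [cyc y A]. *)
Lemma cyc_cut x y A B : uniq (x :: A ++ y :: B) ->
  tperm x y * cyc x (A ++ y :: B) = cyc y A * cyc x B.
Proof.
move=> U; rewrite cyc_cat cyc_cons !mulgA; congr (_ * _).
have -> : tperm x y * cyc x A * tperm x y = cyc x A ^ tperm x y by rewrite conjgE tpermV mulgA.
rewrite cycJ tpermL; congr (cyc _ _); apply: map_id_in => z zA.
move: U; rewrite /= mem_cat cat_uniq => /and3P[xn _ /and3P[/hasPn yA _]].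
rewrite tpermD //; first by apply: contraNneq xn => ->; rewrite zA.
by have := yA y; rewrite inE eqxx => /(_ isT); apply: contraNneq => ->.
Qed.

Lemma cyc_join x y A B : uniq (x :: A ++ y :: B) ->
  tperm x y * cyc y A * cyc x B = cyc x (A ++ y :: B).
Proof. by move=> U; rewrite -mulgA -cyc_cut // mulgA tperm2 mul1g. Qed.

(** Both sides are [tperm x y] times the disjoint, hence commuting, cycles [cyc y A] and
    [cyc x B]. *)
Lemma cyc_rotate x y A B : uniq (x :: A ++ y :: B) -> cyc x (A ++ y :: B) = cyc y (B ++ x :: A).
Proof.
move=> U; have U' : uniq (y :: B ++ x :: A).
  by rewrite -(cat_cons y) uniq_catC.
rewrite -cyc_join // -cyc_join // tpermC -!mulgA; congr (_ * _).
apply: cyc_comm; rewrite -(perm_uniq (s1 := x :: A ++ y :: B)) //.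
by apply/seq.permP=> P; rewrite /= !count_cat /=; lia.
Qed.

Lemma uniq_sub s t : uniq t -> (forall P : pred T, count P s <= count P t) -> uniq s.
Proof.
move=> Ut le_st; apply: count_mem_uniq => x.
rewrite -has_pred1 has_count; have := le_st (pred1 x); rewrite (count_uniq_mem x Ut).
by case: (x \in t) (count _ s) => [] [|[|k]].
Qed.

Lemma fcycle_stable (P : T -> Prop) d s x y :
  fcycle d s -> (forall z, P z -> P (d z)) -> x \in s -> y \in s -> P x -> P y.
Proof.
move=> fc Pd xs ys Px.
have /iter_findex <- : fconnect d x y by rewrite (fconnect_cycle fc).
by elim: (findex _ _ _) => //= k; apply: Pd.
Qed.

(** Writing t for [tperm z o] and C for the cycle through o, the cycle through z is C^t, so the
    quotient is t times the conjugate of t by C^-1; C fixes z and sends x to o. *)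
Lemma cyc_ratio z o X x : uniq [:: z, o & rcons X x] ->
  cyc z (rcons X x) * (cyc o (rcons X x))^-1 = tperm z o * tperm z x.
Proof.
move=> /= /andP[]; rewrite inE negb_or => /andP[zo zX] /andP[oX UX].
have -> : cyc z (rcons X x) = cyc o (rcons X x) ^ tperm z o.
  rewrite cycJ tpermR; congr (cyc _ _); apply/esym/map_id_in => y yX.
  by rewrite tpermD //; apply: contraTneq yX => <-.
have Uo : uniq (o :: rcons X x) by rewrite /= oX.
set C := cyc o _; have Cx : C x = o.
  have := @cyc_nth o (rcons X x) (size X).+1 Uo; rewrite size_rcons leqnn => /(_ isT).
  by rewrite /= nth_rcons ltnn eqxx nth_default ?size_rcons.
have Cz : C z = z by rewrite cyc_out // inE negb_or zo.
have -> : tperm z x = tperm z o ^ C^-1 by rewrite tpermJ -{2}Cz -Cx !permK.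
by rewrite !conjgE tpermV invgK !mulgA.
Qed.

Lemma tperm_comm x y z t : uniq [:: x; y; z; t] -> commute (tperm x y) (tperm z t).
Proof.
rewrite /= !inE !negb_or -!andbA => /and5P[xy xz xt yz /and3P[yt zt _]].
by apply/commgP/conjg_fixP; rewrite tpermJ !tpermD // eq_sym.
Qed.

Lemma cyc3_sq x y z : y != x -> z != x -> z != y -> cyc3 x y z * cyc3 x y z = cyc3 x z y.
Proof.
move=> yx zx zy; have [Ex Ey Ez out] := cyc3E yx zx zy.
have [Fx Fz Fy out'] : [/\ cyc3 x z y x = z, cyc3 x z y z = y, cyc3 x z y y = x
    & forall t, t != x -> t != z -> t != y -> cyc3 x z y t = t].
  by apply: cyc3E => //; rewrite eq_sym.
apply/permP=> t; rewrite permM.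
have [->|tx] := eqVneq t x; first by rewrite Ex Ey Fx.
have [->|ty] := eqVneq t y; first by rewrite Ey Ez Fy.
have [->|tz] := eqVneq t z; first by rewrite Ez Ex Fz.
by rewrite !out // out'.
Qed.

(* The cycles a and c traverse their common points in opposite directions, so that a c is
   again a cycle. The word (a c)(c a)^-1 is a double transposition that meets its conjugate
   by a^2 in y only, hence the square of their product is a 3-cycle. *)
Section OddPair.

Variables (z x1 x2 x o o1 o2 y : T) (X O Y : seq T).
Let XX := [:: x1, x2 & rcons X x].
Let OO := [:: o, o1, o2 & O].
Let YY := rcons Y y.
Let a := cyc z (XX ++ OO).
Let c := cyc z (rev OO ++ YY).
Let G := <<[set a; c]>>%G.
Hypothesis Uall : uniq (z :: XX ++ OO ++ YY).

Ltac count_le := move=> P; rewrite /XX /OO /YY -?cats1 /= -?cats1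
  ?(count_cat, count_rev) /= ?(count_cat, count_rev) /=; clear; lia_counts.

Lemma odd_pair_mul : a * c = cyc z (XX ++ YY).
Proof. by rewrite /a /c !cyc_cat cyc_rev mulgA mulgK. Qed.

(** The product c a is the conjugate of [cyc z (YY ++ XX)] by [cyc z OO], which moves z to o and
    fixes XX and YY. *)
Lemma odd_pair_comm : c * a = cyc o (YY ++ XX).
Proof.
have : uniq ((z :: OO) ++ YY ++ XX).
  by apply: uniq_sub Uall _; count_le.
rewrite cat_uniq => /and3P[Uo /hasPn dis _].
have -> : c * a = cyc z (YY ++ XX) ^ cyc z OO.
  by rewrite /a /c !cyc_cat cyc_rev conjgE !mulgA.
rewrite cycJ cyc_head //; congr (cyc _ _); apply: map_id_in => w wYX.
by rewrite cyc_out // dis.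
Qed.

Lemma odd_pair_commutator : a * c * (c * a)^-1 = tperm o x * tperm z y.
Proof.
rewrite odd_pair_mul odd_pair_comm !cyc_cat invMg.
have comm : commute (cyc z YY) (cyc o XX)^-1.
  apply/commuteV/cyc_comm; apply: uniq_sub Uall _; count_le.
have -> : cyc z XX * cyc z YY * ((cyc o XX)^-1 * (cyc o YY)^-1)
    = (cyc z XX * (cyc o XX)^-1) * (cyc z YY * (cyc o YY)^-1).
  by rewrite -!mulgA; congr (_ * _); rewrite !mulgA comm.
rewrite (@cyc_ratio z o [:: x1, x2 & X]); last first.
  by apply: uniq_sub Uall _; count_le.
rewrite cyc_ratio; last first.
  by apply: uniq_sub Uall _; count_le.
have Uzox : uniq [:: z; o; x].
  by apply: uniq_sub Uall _; count_le.
have <- : tperm z x ^ tperm z o = tperm o x.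
  move: Uzox; rewrite /= !inE !negb_or => /and3P[/andP[zo zx] ox _].
  by rewrite tpermJ tpermL tpermD // eq_sym.
by rewrite conjgE tpermV !mulgA.
Qed.

Lemma odd_pair_cyc3 : cyc3 y x2 z \in G.
Proof.
have aG : a \in G by rewrite mem_gen // !inE eqxx.
have cG : c \in G by rewrite mem_gen // !inE eqxx orbT.
have tG : tperm o x * tperm z y \in G.
  by rewrite -odd_pair_commutator groupM ?groupV ?groupM.
have Ua : uniq (z :: XX ++ OO).
  by apply: uniq_sub Uall _; count_le.
have ay : a y = y.
  have := Uall; rewrite catA -cat_cons cat_uniq => /and3P[_ /hasPn dis _].
  by apply/cyc_out/dis; rewrite mem_rcons inE eqxx.
have := cyc_fcycle Ua; rewrite -/a /= rcons_cat cat_path last_rcons /=.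
case/and5P=> /eqP az /eqP ax1 _ /eqP ax /and3P[/eqP ao /eqP ao1 _].
(* Since [a ^+ 2] sends o, x, z to o2, o1, x2 and fixes y, the conjugate of (o x)(z y) is (o2 o1)(x2
   y). *)
have := groupM tG (groupJ tG (groupX 2 aG)).
rewrite conjMg !tpermJ !permX /= az ax1 ax ao ao1 !ay => t2G.
have U8 : uniq [:: o; x; o2; o1; y; z; x2].
  by apply: uniq_sub Uall _; count_le.
have := groupX 2 t2G.
have -> : tperm o x * tperm z y * (tperm o2 o1 * tperm x2 y)
    = (tperm o x * tperm o2 o1) * cyc3 y z x2.
  rewrite /cyc3 (tpermC y) (tpermC y) -!mulgA; congr (_ * _); rewrite !mulgA; congr (_ * _).
  by apply: tperm_comm; apply: uniq_sub U8 _; count_le.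
have comm1 : commute (tperm o x) (tperm o2 o1).
  by apply: tperm_comm; apply: uniq_sub U8 _; count_le.
have comm2 : commute (tperm o x * tperm o2 o1) (cyc3 y z x2).
  apply/commute_sym/commuteM; apply/commute_sym/commuteM;
  by apply: tperm_comm; apply: uniq_sub U8 _; count_le.
rewrite (expgMn 2 comm2) (expgMn 2 comm1) !expg2 !tperm2 !mul1g.
move: U8; rewrite /= !inE !negb_or => /and5P[_ _ _ _ /and3P[/andP[yz yx2] zx2 _]].
by rewrite cyc3_sq // eq_sym.
Qed.

(** The class of y contains y, fixed by a, and x2, fixed by c, so it is stable under both. It
    contains z, which lies on both cycles, and these cover T. *)
Lemma Alt_sub_odd_pair : (forall t, t \in z :: XX ++ OO ++ YY) -> 'Alt_T \subset G.
Proof.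
move=> allT; apply: (@Alt_sub_linked _ y) => t.
have aG : a \in G by rewrite mem_gen // !inE eqxx.
have cG : c \in G by rewrite mem_gen // !inE eqxx orbT.
have [zy x2y x2z] : [/\ z != y, x2 != y & z != x2].
  have : uniq [:: y; z; x2].
    by apply: uniq_sub Uall _; count_le.
  by rewrite /= !inE !negb_or => /and3P[/andP[yz yx2] zx2 _]; rewrite zx2 ![_ == y]eq_sym.
have [yx2L yzL _] := cyc3_linked x2y zy x2z odd_pair_cyc3.
have Ua : uniq (z :: XX ++ OO) by apply: uniq_sub Uall _; count_le.
have Uc : uniq (z :: rev OO ++ YY) by apply: uniq_sub Uall _; count_le.
have ay : a y = y.
  have := Uall; rewrite catA -cat_cons cat_uniq => /and3P[_ /hasPn dis _].
  by apply/cyc_out/dis; rewrite mem_rcons inE eqxx.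
have cx2 : c x2 = x2.
  apply: cyc_out; suffices : uniq (x2 :: z :: rev OO ++ YY) by case/andP.
  by apply: uniq_sub Uall _; count_le.
have yy : linked G y y by rewrite /linked eqxx.
have a_st : forall w, linked G y w -> linked G y (a w) by apply: (linked_stable aG yy); rewrite ay.
have c_st : forall w, linked G y w -> linked G y (c w).
  by apply: (linked_stable cG yx2L); rewrite cx2.
have /orP[ta|tc] : (t \in z :: XX ++ OO) || (t \in z :: rev OO ++ YY).
  have := allT t; rewrite catA -cat_cons mem_cat => /orP[->//|tY].
  by rewrite orbC -cat_cons mem_cat tY orbT.
- exact: fcycle_stable (cyc_fcycle Ua) a_st (mem_head _ _) ta yzL.
- exact: fcycle_stable (cyc_fcycle Uc) c_st (mem_head _ _) tc yzL.
Qed.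

End OddPair.

End Cycles.

(** * Products of disjoint transpositions *)

Section Matchings.

Variable T : finType.
Implicit Types (c d : {perm T}) (x y z : T) (ps : seq (T * T)) (qs : seq (T * T * T * T)).

Definition tperms ps : {perm T} := \prod_(p <- ps) tperm p.1 p.2.

Definition points ps : seq T := flatten [seq [:: p.1; p.2] | p <- ps].

Lemma tperms_cat ps ps' : tperms (ps ++ ps') = tperms ps * tperms ps'.
Proof. exact: big_cat. Qed.

Lemma tperms_out ps z : z \notin points ps -> tperms ps z = z.
Proof.
elim: ps => [|p ps IHps]; first by rewrite /tperms big_nil perm1.
rewrite /= !inE !negb_or => /and3P[zp1 zp2 /IHps zps].
by rewrite /tperms big_cons permM tpermD 1?eq_sym.
Qed.

Lemma tperms_in ps p : uniq (points ps) -> p \in ps ->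
  tperms ps p.1 = p.2 /\ tperms ps p.2 = p.1.
Proof.
elim: ps => //= q ps IHps; rewrite inE negb_or => /and3P[/andP[q12 q1] q2 /IHps{}IHps].
rewrite /tperms big_cons !permM inE => /predU1P[->|p_ps].
  by rewrite tpermL tpermR !tperms_out.
have [p1 p2] : p.1 \in points ps /\ p.2 \in points ps.
  by split; apply/flatten_mapP; exists p; rewrite // !inE eqxx ?orbT.
rewrite !tpermD; first exact: IHps.
all: by [apply: contraNneq q1 => -> | apply: contraNneq q2 => ->].
Qed.

Lemma tperms_sq ps : uniq (points ps) -> tperms ps ^+ 2 = 1.
Proof.
move=> Ups; apply/permP=> z; rewrite expg2 permM perm1.
have [/flatten_mapP[p p_ps]|zps] := boolP (z \in points ps); last by rewrite !tperms_out.
have [p12 p21] := tperms_in Ups p_ps.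
by rewrite !inE => /orP[] /eqP->; rewrite ?p12 ?p21 ?p12.
Qed.

Lemma odd_tperms ps : uniq (points ps) -> odd_perm (tperms ps) = odd (size ps).
Proof.
move=> Ups; apply: odd_perm_prod; apply/allP=> p p_ps.
elim: ps Ups p_ps => //= q ps IHps; rewrite inE negb_or => /and3P[/andP[q12 _] _ /IHps{}IHps].
by rewrite inE => /predU1P[->|/IHps].
Qed.

(* If d maps w -> g -> g' and fixes f, then (w f)(g g') d maps w -> f -> g and fixes g'. *)
Lemma swap_conj d f w g g' : uniq [:: f; w; g; g'] -> d w = g -> d g = g' -> d f = f ->
  tperm w f * (tperm g g' * d) = d ^ cyc3 f g' g.
Proof.
rewrite /= !inE !negb_or -!andbA => /and5P[fw fg fg' wg /and3P[wg' gg' _]] dw dg df.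
have [Ef Eg' Eg out] : [/\ cyc3 f g' g f = g', cyc3 f g' g g' = g, cyc3 f g' g g = f
    & forall t, t != f -> t != g' -> t != g -> cyc3 f g' g t = t].
  by apply: cyc3E => //; rewrite eq_sym.
move: (cyc3 f g' g) Ef Eg' Eg out => S Ef Eg' Eg out.
rewrite conjgE; apply: (mulgI S); rewrite mulKVg.
apply/permP=> t; rewrite !permM.
have dinj u v : (d u == d v) = (u == v) by rewrite (inj_eq perm_inj).
have [->|tf] := eqVneq t f.
  by rewrite Ef df Ef (tpermD (z := g')) // tpermR dg.
have [->|tw] := eqVneq t w.
  by rewrite (out w) // 1?eq_sym // tpermL tpermD // 1?eq_sym // df dw Eg.
have [->|tg] := eqVneq t g.
  by rewrite Eg tpermR tpermD // 1?eq_sym // dw dg Eg'.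
have Sdt : S (d t) = d t.
  by apply: out; [rewrite -df | rewrite -dg | rewrite -dw]; rewrite dinj.
have [tg'|tg'] := eqVneq t g'.
  by rewrite Sdt tg' Eg' (tpermD (z := g)) // 1?eq_sym // tpermL.
by rewrite Sdt out // !tpermD // eq_sym.
Qed.

(** A quadruple (f, w, g, g') contributes the transpositions (w f) and (g g') of [swap_conj]. *)
Definition swap_pairs qs : seq (T * T) :=
  flatten [seq [:: (q.1.1.2, q.1.1.1); (q.1.2, q.2)] | q <- qs].

(** The transpositions of the other quadruples fix f, w, g, so by [swap_conj] each quadruple only
    conjugates the product of the rest with d. *)
Lemma swaps_order d qs M : d ^+ M = 1 -> uniq (points (swap_pairs qs)) ->
    (forall f w g g', (f, w, g, g') \in qs -> [/\ d w = g, d g = g' & d f = f]) ->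
  (tperms (swap_pairs qs) * d) ^+ M = 1.
Proof.
move=> dM; elim: qs => [|[[[f w] g] g'] qs IHqs].
  by rewrite /tperms big_nil mul1g.
rewrite /= !inE !negb_or -!andbA => /and5P[wf wg wg' wqs].
case/and5P=> fg fg' fqs gg' /and3P[gqs g'qs Uqs] dqs.
have /IHqs{}IHqs := Uqs.
rewrite {1}/tperms !big_cons -!mulgA swap_conj /=.
- by rewrite -conjXg IHqs ?conj1g // => *; apply: dqs; rewrite inE; apply/orP; right.
- by rewrite !inE !negb_or eq_sym wf fg fg' wg wg' gg'.
all: by have [dw dg df] := dqs f w g g' (mem_head _ _); rewrite permM tperms_out.
Qed.

End Matchings.

Lemma cyc_consec (T : finType) (x : T) A y z B : uniq (x :: A ++ [:: y, z & B]) ->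
  cyc x (A ++ [:: y, z & B]) y = z.
Proof.
move=> U; have lt : (size A).+1 <= size (A ++ [:: y, z & B]) by rewrite size_cat /=; lia.
by have := cyc_nth U lt; rewrite /= !nth_cat ltnn subnn ltnNge leqW //= subSnn.
Qed.

(* In the product a c the factor (w u1)(x y) of a puts the 4-cycle (u1 u2 u3 u4) of c into
   the long cycle and takes y, z1, z2, z3 out as a 4-cycle, while each factor (v f)(g g')
   puts the fixed point f in and takes g' out: a c has the cycle type of c. *)
Section EvenPair.

Variable T : finType.
Variables (w x z1 z2 z3 y u1 u2 u3 u4 : T) (qs : seq (T * T * T * T)) (R : seq T) (h : nat).

(** In a quadruple (f, v, g, g') the points v, g, g' will be consecutive on the long cycle of c, and
    f a fixed point of c. *)
Definition swap_triples (l : seq (T * T * T * T)) : seq T :=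
  flatten [seq [:: q.1.1.2; q.1.2; q.2] | q <- l].
Definition swap_fixed (l : seq (T * T * T * T)) : seq T := [seq q.1.1.1 | q <- l].

Let Z := [:: z1; z2; z3].
Let Q := swap_triples qs ++ R.
Let P := x :: Z ++ y :: Q.
Let U := [:: u2; u3; u4].
Let F := swap_fixed qs.
Let c := cyc w P * cyc u1 U.
Let ps := swap_pairs qs ++ [:: (x, y); (w, u1)].
Let a := tperms ps.
Let G := <<[set a; c]>>%G.
Let L := 4 * h + 2.

Hypothesis Uall : uniq (w :: P ++ u1 :: U ++ F).
Hypothesis sizeP : size (w :: P) = L.

Lemma count_points_swap_pairs (B : pred T) :
  count B (points (swap_pairs qs)) = count B (swap_triples qs) + count B F.
Proof. by rewrite /F; elim: qs => //= q qs' IHqs; rewrite -[flatten _]/(points _) IHqs -[flatten _]/(swap_triples _); lia. Qed.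

Lemma points_cat (ps1 ps2 : seq (T * T)) : points (ps1 ++ ps2) = points ps1 ++ points ps2.
Proof. by rewrite /points map_cat flatten_cat. Qed.

Local Ltac count_le := move=> B; rewrite /= /ps /P /Z /U /Q ?points_cat /=
   ?(count_cat, count_points_swap_pairs) /= ?(count_cat, count_points_swap_pairs) /=;
   clear; lia_counts.

Let Ups : uniq (points ps).
Proof. by apply: uniq_sub Uall _; count_le. Qed.

Let UP : uniq (w :: P).
Proof. by apply: uniq_sub Uall _; count_le. Qed.

Let UU : uniq (u1 :: U).
Proof. by apply: uniq_sub Uall _; count_le. Qed.

Let notin_cat (s t : seq T) z : uniq (s ++ t) -> z \in s -> z \notin t.
Proof. by rewrite cat_uniq => /and3P[_ /hasPn dis _]; apply: contraL => /dis. Qed.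

Lemma even_pair_sq : a ^+ 2 = 1.
Proof. exact: tperms_sq. Qed.

Lemma even_pair_even : ~~ odd_perm a /\ ~~ odd_perm c.
Proof.
split; first by rewrite odd_tperms // size_cat oddD addbF; elim: qs => //= q l IHl; rewrite negbK.
rewrite odd_permM !odd_cyc //.
have -> : size P = (4 * h).+1 by move: sizeP; rewrite /L /=; lia.
by rewrite /= oddM.
Qed.

Lemma even_pair_comm : commute (cyc w P) (cyc u1 U).
Proof. by apply: cyc_comm; apply: uniq_sub Uall _; count_le. Qed.

(** L is the length of the long cycle and is 2 modulo 4, so only the square of the 4-cycle
    survives. *)
Lemma even_pair_cL : c ^+ L = tperm u1 u3 * tperm u2 u4.
Proof.
rewrite (expgMn _ even_pair_comm) -{1}sizeP cyc_order // mul1g.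
have -> : cyc u1 U ^+ L = cyc u1 U ^+ 2.
  by rewrite /L expgD expgM (@cyc_order _ u1 U UU) expg1n mul1g.
have := cyc_fcycle UU; rewrite /= andbT => /and4P[/eqP e1 /eqP e2 /eqP e3 /eqP e4].
have : uniq [:: u1; u2; u3; u4] by exact: UU.
rewrite /= !inE !negb_or -!andbA => /and5P[u12 u13 u14 u23 /and3P[u24 u34 _]].
apply/permP=> t; rewrite expg2 !permM.
have [->|t1] := eqVneq t u1; first by rewrite e1 e2 tpermL tpermD // eq_sym.
have [->|t2] := eqVneq t u2; first by rewrite e2 e3 (tpermD (z := u2)) ?tpermL // eq_sym.
have [->|t3] := eqVneq t u3; first by rewrite e3 e4 tpermR tpermD // eq_sym.
have [->|t4] := eqVneq t u4; first by rewrite e4 e1 (tpermD (z := u4)) ?tpermR // eq_sym.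
by rewrite !cyc_out ?tpermD // 1?eq_sym // !inE !negb_or t1 t2 t3.
Qed.

Lemma even_pair_order : c ^+ (2 * L) = 1.
Proof.
rewrite mulnC expgM even_pair_cL expgMn ?expg2 ?tperm2 ?mulg1 //.
by apply: tperm_comm; apply: uniq_sub UU _; count_le.
Qed.

Lemma even_pair_c_P t : t \in w :: P -> c t = cyc w P t.
Proof.
move=> tP; rewrite /c even_pair_comm permM (@cyc_out _ u1) //.
by apply: notin_cat tP; apply: uniq_sub Uall _; count_le.
Qed.

Lemma even_pair_a_x : [/\ a x = y, a w = u1 & a u1 = w].
Proof.
have [xps wps] : (x, y) \in ps /\ (w, u1) \in ps by rewrite !mem_cat !inE !eqxx !orbT.
have [? ?] := tperms_in Ups xps; have [? ?] := tperms_in Ups wps.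
by [].
Qed.

Lemma even_pair_c_swap f v g g' : (f, v, g, g') \in qs ->
  [/\ c v = g, c g = g' & c f = f].
Proof.
move=> q_qs.
have [l1 [l2 qsE]] : exists l1 l2, qs = l1 ++ (f, v, g, g') :: l2.
  by case/splitPr: q_qs => l1 l2; exists l1, l2.
have PE : P = ([:: x, z1, z2, z3, y & swap_triples l1] ++ [:: v, g, g' & swap_triples l2 ++ R])%SEQ.
  by rewrite /P /Z /Q qsE /swap_triples map_cat flatten_cat /= -!catA.
have UP' := UP; rewrite PE in UP'.
have PE' : P = (rcons [:: x, z1, z2, z3, y & swap_triples l1] v ++ [:: g, g' & swap_triples l2 ++ R])%SEQ.
  by rewrite PE cat_rcons.
have UP'' := UP; rewrite PE' in UP''.
have vP : v \in w :: P by rewrite PE inE mem_cat !inE eqxx !orbT.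
have gP : g \in w :: P by rewrite PE inE mem_cat !inE eqxx !orbT.
rewrite (even_pair_c_P vP) (even_pair_c_P gP); split.
- by rewrite PE cyc_consec.
- by rewrite PE' cyc_consec.
have fF : f \in F by apply/mapP; exists (f, v, g, g').
have : f \notin w :: P ++ u1 :: U.
  by apply: (@notin_cat F _ f _ fF); apply: uniq_sub Uall _; count_le.
rewrite -cat_cons mem_cat negb_or => /andP[fP fU].
by rewrite /c permM !cyc_out.
Qed.

Lemma even_pair_mul_order : (a * c) ^+ (2 * L) = 1.
Proof.
rewrite /a tperms_cat -mulgA; apply: swaps_order.
(* First (w u1) joins the two cycles of c, then (x y) cuts the result after a rotation that puts x
   in front. The pieces have lengths 4 and again L, as four points leave the long cycle and four
   enter it. *)
- have -> : tperms [:: (x, y); (w, u1)] * c = cyc y Z * cyc x (Q ++ w :: rcons U u1).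
    rewrite /tperms !big_cons big_nil mulg1 /= /c even_pair_comm -mulgA [tperm w u1 * _]mulgA.
    rewrite cyc_join; last by apply: uniq_sub Uall _; count_le.
    rewrite /P -cat_rcons cyc_rotate; last first.
      by apply: uniq_sub Uall _; rewrite -cats1; count_le.
    rewrite -catA cyc_cut //.
    by apply: uniq_sub Uall _; rewrite -cats1; count_le.
  have comm : commute (cyc y Z) (cyc x (Q ++ w :: rcons U u1)).
    by apply: cyc_comm; apply: uniq_sub Uall _; rewrite -cats1; count_le.
  rewrite (expgMn _ comm).
  have -> : cyc y Z ^+ (2 * L) = 1.
    have UZ : uniq (y :: Z) by apply: uniq_sub Uall _; count_le.
    rewrite (_ : 2 * L = (size Z).+1 * (2 * h + 1))%N; last by rewrite /L /=; lia.
    by rewrite expgM cyc_order // expg1n.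
  have UX : uniq (x :: Q ++ w :: rcons U u1).
    by apply: uniq_sub Uall _; rewrite -cats1; count_le.
  rewrite mul1g (_ : 2 * L = (size (Q ++ w :: rcons U u1)).+1 * 2)%N.
    by rewrite expgM cyc_order // expg1n.
  by rewrite mulnC -sizeP /P /Z /U /= !size_cat /=; lia.
- by apply: uniq_sub Uall _; count_le.
move=> f v g g' q_qs; have [cv cg cf] := even_pair_c_swap q_qs.
have dE t : t \in points (swap_pairs qs) -> (tperms [:: (x, y); (w, u1)] * c) t = c t.
  by move=> tq; rewrite permM tperms_out //; apply: notin_cat tq; rewrite -points_cat.
rewrite !dE ?cv ?cg ?cf //; apply/flatten_mapP.
- by exists (v, f); rewrite ?inE ?eqxx ?orbT //; apply/flatten_mapP; exists (f, v, g, g'); rewrite ?inE ?eqxx.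
- by exists (g, g'); rewrite ?inE ?eqxx ?orbT //; apply/flatten_mapP; exists (f, v, g, g'); rewrite ?inE ?eqxx ?orbT.
- by exists (v, f); rewrite ?inE ?eqxx ?orbT //; apply/flatten_mapP; exists (f, v, g, g'); rewrite ?inE ?eqxx.
Qed.

Let aG : a \in G. Proof. by rewrite mem_gen // !inE eqxx. Qed.
Let cG : c \in G. Proof. by rewrite mem_gen // !inE eqxx orbT. Qed.

Lemma even_pair_a_fix t : t \in [:: u2; u3; u4] -> a t = t.
Proof.
move=> tU; apply: tperms_out; apply: notin_cat tU.
by apply: uniq_sub Uall _; count_le.
Qed.

Let U5 : [/\ u1 != u3, w != u3, w != u1, u2 != u4 & uniq [:: w; u3; u2; u4]].
Proof.
have Uw : uniq [:: w; u3; u2; u4] by apply: uniq_sub Uall _; count_le.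
suffices: [/\ u1 != u3, w != u3, w != u1 & u2 != u4] by case.
have : uniq [:: w; u1; u3; u2; u4] by apply: uniq_sub Uall _; count_le.
rewrite /= !inE !negb_or -!andbA.
by case/and5P=> wu1 wu3 wu2 wu4 /and5P[u13 u12 u14 u32 /and3P[u34 u24 _]].
Qed.

(** Of the points moved by c^L = (u1 u3)(u2 u4) the involution a moves only u1, to w. Multiplying by
    the conjugate under a leaves (u1 u3)(w u3). *)
Lemma even_pair_cyc3 : cyc3 u3 u1 w \in G.
Proof.
have tG := groupX L cG; rewrite even_pair_cL in tG.
have := groupM tG (groupJ tG aG); have [_ _ au1] := even_pair_a_x.
rewrite conjMg !tpermJ au1 !even_pair_a_fix ?inE ?eqxx ?orbT //.
have [_ _ _ _ Uw] := U5.
have comm : commute (tperm w u3) (tperm u2 u4) by apply: tperm_comm.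
by rewrite comm mulgA -[_ * _ * tperm u2 u4]mulgA tperm2 mulg1 /cyc3 tpermC (tpermC u3 w).
Qed.

Lemma even_pair_odd_order : ~~ odd #[a] /\ ~~ odd #[c].
Proof.
have [u13 _ wu1 _ _] := U5; have [_ aw _] := even_pair_a_x.
split; apply/negP=> odd_order.
  have : #[a] %| 1 by rewrite -(Gauss_dvdr 1 (_ : coprime #[a] 2)) ?muln1 ?coprimen2 // order_dvdn even_pair_sq.
  by rewrite dvdn1 order_eq1 => /eqP a1; move: aw; rewrite a1 perm1 => /eqP; rewrite (negbTE wu1).
have : #[c] %| L by rewrite -(Gauss_dvdr L (_ : coprime #[c] 2)) ?coprimen2 // order_dvdn even_pair_order.
rewrite order_dvdn even_pair_cL => /eqP/permP/(_ u1).
have : uniq [:: u1; u3; u2; u4] by apply: uniq_sub UU _; count_le.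
rewrite /= !inE !negb_or -!andbA => /and5P[_ _ _ u32 /and3P[u34 _ _]].
by rewrite permM tpermL perm1 tpermD 1?eq_sym // => /eqP; rewrite eq_sym (negbTE u13).
Qed.

(** The class of u1 contains w = a u1 and u3 = c^2 u1, so it is stable under a and c^2. These reach
    the point v of a first quadruple and f = a v; as c fixes f, the class is stable under c too. *)
Lemma Alt_sub_even_pair : qs != [::] -> (forall t, t \in w :: P ++ u1 :: U ++ F) ->
  'Alt_T \subset G.
Proof.
move=> qs0 allT; apply: (@Alt_sub_linked _ u1) => t.
have [u13 wu3 wu1 _ _] := U5; have [_ aw au1] := even_pair_a_x.
have [u31 u3w u1w] := cyc3_linked u13 wu3 wu1 even_pair_cyc3.
have u11 : linked G u1 u1 by rewrite /linked eqxx.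
have a_st : forall v, linked G u1 v -> linked G u1 (a v).
  by apply: (linked_stable aG u11); rewrite au1.
have := cyc_fcycle UU; rewrite /= andbT => /and4P[/eqP e1 /eqP e2 /eqP e3 /eqP e4].
have c_U v : v \in u1 :: U -> c v = cyc u1 U v.
  move=> vU; rewrite /c permM (@cyc_out _ w P) //.
  by apply: notin_cat vU; apply: uniq_sub Uall _; count_le.
have c2_st : forall v, linked G u1 v -> linked G u1 ((c ^+ 2) v).
  apply: (linked_stable (groupX 2 cG) u11).
  by rewrite expg2 permM !c_U ?inE ?eqxx ?orbT // ?e1 ?e2 ?inE ?eqxx ?orbT //; apply: linked_sym.
have [f [v [g [g' [l qsE]]]]] : exists f v g g' l, qs = (f, v, g, g') :: l.
  by case: qs qs0 => // [[[[f v] g] g'] l] _; exists f, v, g, g', l.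
have q_qs : (f, v, g, g') \in qs by rewrite qsE mem_head.
have [_ _ cf] := even_pair_c_swap q_qs.
have [av avf] : a v = f /\ a f = v.
  have vf_ps : (v, f) \in ps.
    rewrite mem_cat; apply/orP; left; apply/flatten_mapP.
    by exists (f, v, g, g'); rewrite // inE eqxx.
  exact: tperms_in Ups vf_ps.
(* On the long cycle w is followed by x, z1, z2, z3, y, v: the distance 6 is even. *)
have c6w : (c ^+ 2) ((c ^+ 2) ((c ^+ 2) w)) = v.
  have PE : P = [:: x, z1, z2, z3, y, v & behead Q] by rewrite /P /Q qsE.
  have := cyc_fcycle UP; rewrite {2}PE /=.
  case/and5P=> /eqP cw /eqP cx /eqP cz1 /eqP cz2 /and3P[/eqP cz3 /eqP cy _].
  have inP t' : t' \in [:: w; x; z1; z2; z3; y] -> t' \in w :: P.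
    by rewrite PE !inE; do 5!(case/orP=> [->|]; first by rewrite ?orbT); move->; rewrite !orbT.
  by rewrite !permX /= !even_pair_c_P ?cw ?cx ?cz1 ?cz2 ?cz3 ?cy // inP // !inE eqxx ?orbT.
have u1v : linked G u1 v by rewrite -c6w; do 3!apply/c2_st.
have u1f : linked G u1 f by rewrite -av; apply: a_st.
have c_st : forall v, linked G u1 v -> linked G u1 (c v).
  by apply: (linked_stable cG u1f); rewrite cf.
have PG v' : v' \in w :: P -> linked G u1 v'.
  move=> v'P; have [] // : v' \in w :: P /\ linked G u1 v'.
  apply: (@fcycle_stable _ (fun r => r \in w :: P /\ linked G u1 r) _ _ _ _ (cyc_fcycle UP) _ (mem_head _ _) v'P).
    move=> r [rP u1r]; rewrite (mem_fcycle (cyc_fcycle UP)) //.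
    by split=> //; rewrite -even_pair_c_P //; apply: c_st.
  by rewrite mem_head.
have := allT t; rewrite -cat_cons mem_cat -cat_cons mem_cat.
case/or3P=> [tP|tU|/mapP[[[[f' v'] r] r'] f_qs ->]]; first exact: PG.
  have [] // : t \in u1 :: U /\ linked G u1 t.
  apply: (@fcycle_stable _ (fun r => r \in u1 :: U /\ linked G u1 r) _ _ _ _ (cyc_fcycle UU) _ (mem_head _ _) tU).
    move=> r [rU u1r]; rewrite (mem_fcycle (cyc_fcycle UU)) //.
    by split=> //; rewrite -c_U //; apply: c_st.
  by rewrite mem_head.
have v'f'_ps : (v', f') \in ps.
  rewrite mem_cat; apply/orP; left; apply/flatten_mapP.
  by exists (f', v', r, r'); rewrite // inE eqxx.
have [/= av' _] := tperms_in Ups v'f'_ps; rewrite /= -[X in linked _ _ X]av'.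
apply/a_st/PG; rewrite /P /Q !inE !mem_cat; do 6!(apply/orP; right); apply/orP; left.
by apply/flatten_mapP; exists (f', v', r, r'); rewrite // inE eqxx.
Qed.

End EvenPair.

(** * The two generating triples of the alternating group *)

Section Alternating.

Variable T : finType.

Lemma mem_sub (s1 s2 : seq T) t :
  t \in s1 -> (forall B : pred T, count B s1 <= count B s2) -> t \in s2.
Proof. by rewrite -!has_pred1 !has_count => /leq_trans tP /(_ (pred1 t))/tP. Qed.

Lemma Alt_gen_odd_order : 'Alt_T \subset <<[set s in 'Alt_T | odd #[s]]>>.
Proof.
have [p _|T0] := pickP (fun _ : T => true); last first.
  by rewrite trivial_Alt_2 ?sub1G // eq_card0.
apply: (@Alt_sub_star _ p) => x y xp yp yx; apply: mem_gen; rewrite inE Alt_even.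
rewrite /cyc3 odd_permM !odd_tperm eq_sym xp eq_sym yp /=.
have /dvdn_odd : #[cyc3 p x y] %| 3.
  rewrite order_dvdn !expgS expg0 mulg1 mulgA (cyc3_sq xp yp yx).
  by rewrite -[X in X * _]cyc3V mulVg.
exact.
Qed.

Lemma swap_quads (k : nat) (s : seq T) : (4 * k <= size s)%N ->
  exists qs R, size qs = k /\
    forall B : pred T, count B (swap_fixed qs) + (count B (swap_triples qs) + count B R) = count B s.
Proof.
elim: k s => [|k IHk] s; first by exists [::], s.
case: s => [|f [|w [|g [|g' s]]]] le_s; try by move: le_s => /=; lia.
have [qs [R [sz_qs perm_s]]] : exists qs R, size qs = k /\
    forall B : pred T, count B (swap_fixed qs) + (count B (swap_triples qs) + count B R) = count B s.
  by apply: IHk; move: le_s => /=; lia.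
exists ((f, w, g, g') :: qs), R; split=> [|B]; first by rewrite /= sz_qs.
by rewrite /= -perm_s -[flatten _]/(swap_triples qs); clear; lia.
Qed.

Lemma size_swap qs : size (@swap_triples T qs) = (3 * size qs)%N /\ size (@swap_fixed T qs) = size qs.
Proof.
rewrite size_map; split=> //; elim: qs => //= q qs IHqs.
by rewrite -[flatten _]/(swap_triples qs) IHqs; lia.
Qed.

Lemma Alt_even_pair h e : #|T| = 4 * h + 2 + e -> 5 <= e <= 8 -> 6 <= h ->
  exists a c : {perm T}, [/\ ~~ odd #[a] /\ ~~ odd #[c],
    a ^+ (8 * h + 4) = 1, c ^+ (8 * h + 4) = 1, (a * c) ^+ (8 * h + 4) = 1
    & <<[set a; c]>> = 'Alt_T].
Proof.
move=> cardT /andP[ge_e le_e] ge_h.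
have sizeE : size (enum T) = 4 * h + 2 + e by rewrite -cardE.
have UE := enum_uniq T; have allE := mem_enum T.
case: (enum T) sizeE UE allE => [|w [|x [|z1 [|z2 [|z3 [|y [|u1 [|u2 [|u3 [|u4 s]]]]]]]]]] sizeE UE allE;
  try by move: sizeE => /=; lia.
(* Outside the long cycle there are e points: u1, ..., u4 and e - 4 fixed points of c, with one
   quadruple for each of the latter. *)
have [|qs [R [sz_qs perm_s]]] := @swap_quads (e - 4) s; first by move: sizeE => /=; lia.
pose L := 4 * h + 2; have LE : 8 * h + 4 = (2 * L)%N by rewrite /L; lia.
have Uall : uniq (w :: (x :: [:: z1; z2; z3] ++ y :: swap_triples qs ++ R) ++ u1 :: [:: u2; u3; u4] ++ swap_fixed qs).
  apply: uniq_sub UE _ => B; have := perm_s B; rewrite /= ?count_cat /= ?count_cat /=.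
  by move: (count B (swap_triples _)) (count B (swap_fixed _)) => n1 n2 <-; clear; lia_counts.
have sizeP : size (w :: x :: [:: z1; z2; z3] ++ y :: swap_triples qs ++ R) = L.
  have := perm_s predT; have [sz3 sz1] := size_swap qs.
  rewrite !count_predT sz1 sz3 sz_qs /= size_cat sz3 sz_qs /L; move: sizeE => /=; lia.
pose c := cyc w (x :: [:: z1; z2; z3] ++ y :: swap_triples qs ++ R) * cyc u1 [:: u2; u3; u4].
pose a := tperms (swap_pairs qs ++ [:: (x, y); (w, u1)]).
have [even_a even_c] := even_pair_even Uall sizeP.
exists a, c; rewrite LE; split.
- exact: even_pair_odd_order Uall sizeP.
- by rewrite expgM (even_pair_sq Uall sizeP) expg1n.
- exact: even_pair_order Uall sizeP.
- exact: even_pair_mul_order Uall sizeP.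
apply/eqP; rewrite eqEsubset gen_subG; apply/andP; split.
  by apply/subsetP=> s' /set2P[] ->; rewrite Alt_even.
apply: (Alt_sub_even_pair Uall sizeP); first by case: qs sz_qs {a c perm_s Uall sizeP even_a even_c} => //=; lia.
move=> t; apply: (mem_sub (etrans (allE t) (erefl true))) => B; have := perm_s B; rewrite /= ?count_cat /= ?count_cat /=.
by move: (count _ (swap_triples _)) (count _ (swap_fixed _)) => n1 n2 <-; clear; lia_counts.
Qed.

(** Cycles of lengths k and l covering T share e points: z and the e - 1 points of the stretch
    traversed in opposite directions. The product omits that stretch, whence its length
    [#|T| + 1 - e]. *)
Lemma Alt_odd_pair k l e : #|T| + e = k + l -> 5 <= e -> odd k -> odd l -> e + 6 <= k -> e + 6 <= l ->
  exists a c : {perm T}, [/\ a ^+ k = 1, c ^+ l = 1, (a * c) ^+ (#|T| + 1 - e) = 1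
    & <<[set a; c]>> = 'Alt_T].
Proof.
move=> cardT ge_e odd_k odd_l le_k le_l.
have sizeE : size (enum T) = #|T| by rewrite -cardE.
have UE := enum_uniq T; have allE := mem_enum T.
move: #|T| cardT sizeE => n cardT.
case: (enum T) UE allE => [|z [|x1 [|x2 [|x [|o [|o1 [|o2 [|y s]]]]]]]] UE allE /= sizeE;
  try by move: sizeE cardT le_k le_l; clear; lia.
pose X := take (k - e - 3) s; pose O := take (e - 4) (drop (k - e - 3) s).
pose Y := drop (e - 4) (drop (k - e - 3) s).
have sE : s = X ++ O ++ Y by rewrite !cat_take_drop.
have sX : size X = k - e - 3 by rewrite size_takel //; move: sizeE cardT ge_e le_k le_l; clear; lia.
have sO : size O = e - 4.
  by rewrite size_takel // size_drop; move: sizeE cardT ge_e le_k le_l; clear; lia.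
have sY : size Y = l - e - 1.
  by rewrite !size_drop; move: sizeE cardT ge_e le_k le_l; clear; lia.
clearbody X O Y; subst s.
have Uall : uniq (z :: [:: x1, x2 & rcons X x] ++ [:: o, o1, o2 & O] ++ rcons Y y).
  by apply: uniq_sub UE _ => B; rewrite /= -!cats1 ?count_cat /= ?count_cat /=; clear; lia_counts.
have Ua : uniq (z :: [:: x1, x2 & rcons X x] ++ [:: o, o1, o2 & O]).
  by apply: uniq_sub UE _ => B; rewrite /= -!cats1 ?count_cat /= ?count_cat /=; clear; lia_counts.
have Uc : uniq (z :: rev [:: o, o1, o2 & O] ++ rcons Y y).
  by apply: uniq_sub UE _ => B; rewrite /= -!cats1 ?(count_cat, count_rev) /= ?count_cat /=; clear; lia_counts.
have Uac : uniq (z :: [:: x1, x2 & rcons X x] ++ rcons Y y).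
  by apply: uniq_sub UE _ => B; rewrite /= -!cats1 ?count_cat /= ?count_cat /=; clear; lia_counts.
have ka : (size ([:: x1, x2 & rcons X x] ++ [:: o, o1, o2 & O])).+1 = k.
  by rewrite /= !(size_cat, size_rcons) /= sX sO; move: ge_e le_k; clear; lia.
have lc : (size (rev [:: o, o1, o2 & O] ++ rcons Y y)).+1 = l.
  by rewrite !(size_cat, size_rcons, size_rev) /= sY sO; move: ge_e le_l; clear; lia.
pose a := cyc z ([:: x1, x2 & rcons X x] ++ [:: o, o1, o2 & O]).
pose c := cyc z (rev [:: o, o1, o2 & O] ++ rcons Y y).
exists a, c; split.
- by rewrite -ka cyc_order.
- by rewrite -lc cyc_order.
- rewrite (odd_pair_mul _ _ _ _ _ _ _ _ _ _ _).
  rewrite (_ : n + 1 - e = (size ([:: x1, x2 & rcons X x] ++ rcons Y y)).+1) ?cyc_order //.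
  rewrite /= !(size_cat, size_rcons) /= sX sY; move: cardT ge_e le_k le_l; clear; lia.
apply/eqP; rewrite eqEsubset gen_subG; apply/andP; split.
  apply/subsetP=> s' /set2P[] ->; rewrite Alt_even odd_cyc //.
    by rewrite -[X in odd X]/(_.+1.-1) ka; case: k odd_k {le_k ka sX cardT}.
  by rewrite -[X in odd X]/(_.+1.-1) lc; case: l odd_l {le_l lc sY cardT}.
apply: Alt_sub_odd_pair Uall _ => t; apply: (mem_sub (etrans (allE t) (erefl true))) => B.
by rewrite /= -!cats1 ?count_cat /= ?count_cat /=; clear; lia_counts.
Qed.

Lemma Alt_mixed_beauville h e k l : #|T| = 4 * h + 2 + e -> 5 <= e <= 8 -> 6 <= h ->
    e + 6 <= k -> e + 6 <= l -> k + l = 4 * h + 2 + (2 * e)%N -> odd k -> odd l ->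
    coprime (2 * h + 1) k -> coprime (2 * h + 1) l ->
  admits_mixed_beauville (H4 'Alt_T).
Proof.
move=> cardT e58 ge_h le_k le_l kl odd_k odd_l co_k co_l.
have [a1 [c1 [[even_a even_c] a1n c1n ac1n gen1]]] := Alt_even_pair cardT e58 ge_h.
have cardTe : #|T| + e = k + l by rewrite cardT kl; clear; lia.
have [ge_e _] := andP e58.
have [a2 [c2 [a2k c2l ac2 gen2]]] := Alt_odd_pair cardTe ge_e odd_k odd_l le_k le_l.
have co4 m : odd m -> coprime (2 * h + 1) m -> coprime (8 * h + 4) m.
  move=> odd_m co_m; rewrite (_ : 8 * h + 4 = (4 * (2 * h + 1))%N); last by lia.
  by rewrite coprimeMl co_m andbT (coprimeXl 2 (_ : coprime 2 m)) ?coprime2n.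
(* All three factors are odd and prime to 2h + 1, the last one being 2(2h + 1) + 1, whereas n1 is
   4(2h + 1). *)
pose n2 := (k * l * (4 * h + 3))%N.
have X (g : {perm T}) m : g ^+ m = 1 -> m %| n2 -> g ^+ n2 = 1.
  by move=> gm /dvdnP[q ->]; rewrite mulnC expgM gm expg1n.
apply: (@H4_mixed_beauville _ _ a1 c1 a2 c2 (8 * h + 4) n2) => //.
- have odd43 : odd (4 * h + 3) by rewrite oddD oddM.
  rewrite /n2 !coprimeMr !co4 //.
  rewrite (_ : 4 * h + 3 = 2 * (2 * h + 1) + 1)%N; last by lia.
  by rewrite /coprime gcdnMDl gcdn1.
- split; [apply: X a2k _ | apply: X c2l _ | apply: X ac2 _]; rewrite /n2.
  + by rewrite -mulnA dvdn_mulr.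
  + by rewrite -mulnAC dvdn_mull.
  + by rewrite (_ : #|T| + 1 - e = 4 * h + 3) ?dvdn_mull // cardT; lia.
- exact: Alt_gen_odd_order.
Qed.

End Alternating.

(** The lengths k and l will differ from 2h + 1 by a power of 2, which makes them prime to it. *)
Lemma coprime_add_2exp m s : odd m -> coprime m (m + 2 ^ s)%N.
Proof. by move=> odd_m; rewrite /coprime gcdnDl; apply: coprimeXr; rewrite coprimen2. Qed.

Lemma Alt_large_mixed_beauville n : 100 <= n -> admits_mixed_beauville (H4 'Alt_('I_n)).
Proof.
move=> le_n; pose h := (n - 7) %/ 4.
have nE : n = 4 * h + 2 + ((n - 7) %% 4 + 5) by have := divn_eq (n - 7) 4; rewrite /h; lia.
have lt4 : (n - 7) %% 4 < 4 by rewrite ltn_mod.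
have ge_h : 20 <= h by move: lt4 nE; clear -le_n; lia.
have odd_h s : odd (2 * h + 1 + 2 ^ s.+1)%N by rewrite oddD oddX addn1 /= oddM.
have cop s : coprime (2 * h + 1) (2 * h + 1 + 2 ^ s)%N by apply: coprime_add_2exp; rewrite addn1 /= oddM.
move: nE lt4; case: ((n - 7) %% 4) => [|[|[|[|//]]]] nE _.
(* The sum of k and l must be 2(2h + 1) + 2e, so 2e is split by signed powers of 2: 10 = 8 + 2, 12 =
   8 + 4, 14 = 16 - 2, 16 = 8 + 8. *)
- by apply: (@Alt_mixed_beauville _ h 5 (2 * h + 1 + 2 ^ 3)%N (2 * h + 1 + 2 ^ 1)%N); rewrite ?card_ord //; lia.
- by apply: (@Alt_mixed_beauville _ h 6 (2 * h + 1 + 2 ^ 3)%N (2 * h + 1 + 2 ^ 2)%N); rewrite ?card_ord //; lia.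
- have lE : (2 * h + 1 = 2 * h - 1 + 2 ^ 1)%N by lia.
  have odd_l : odd (2 * h - 1) by have := odd_h 0; rewrite {1}lE !oddD; case: odd.
  apply: (@Alt_mixed_beauville _ h 7 (2 * h + 1 + 2 ^ 4)%N (2 * h - 1)); rewrite ?card_ord //; try lia.
  by rewrite coprime_sym lE coprime_add_2exp.
- by apply: (@Alt_mixed_beauville _ h 8 (2 * h + 1 + 2 ^ 3)%N (2 * h + 1 + 2 ^ 3)%N); rewrite ?card_ord //; lia.
Qed.

(** * Special linear groups *)

(** An odd power of j is j. So a, having j among its powers, has even order, and so does j c when c
    has odd order. As j is a power of a, the generated group does not change. *)
Lemma even_order_choice (gT : finGroupType) (a c j : gT) i :
    j ^+ 2 = 1 -> j != 1 -> commute j c -> a ^+ i = j ->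
  ~~ odd #[a] /\ exists c', [/\ c' = c \/ c' = j * c, ~~ odd #[c']
    & <<[set a; c']>> = <<[set a; c]>>].
Proof.
move=> j2 j_neq1 jC aj.
have odd_j k : odd k -> j ^+ k = j.
  by move=> odd_k; rewrite -(odd_double_half k) odd_k -mul2n expgD expgM j2 expg1n mulg1.
split.
  apply/negP=> odd_a; case/negP: j_neq1; rewrite -(odd_j _ odd_a) -{1}aj -expgM mulnC expgM.
  by rewrite expg_order expg1n.
have [odd_c|even_c] := boolP (odd #[c]); last by exists c; split=> //; left.
exists (j * c); split; first by right.
  apply/negP=> odd_jc; case/negP: j_neq1.
  have oddk : odd (#[j * c] * #[c]) by rewrite oddM odd_jc.
  have : (j * c) ^+ (#[j * c] * #[c]) = 1 by rewrite expgM expg_order expg1n.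
  by rewrite (expgMn _ jC) (odd_j _ oddk) mulnC expgM expg_order expg1n mulg1 => ->.
apply/eqP; rewrite eqEsubset !gen_subG.
have [aG cG] : a \in <<[set a; c]>> /\ c \in <<[set a; c]>>.
  by rewrite !mem_gen // !inE eqxx ?orbT.
have [aG' cG'] : a \in <<[set a; j * c]>> /\ j * c \in <<[set a; j * c]>>.
  by rewrite !mem_gen // !inE eqxx ?orbT.
apply/andP; split; apply/subsetP=> g /set2P[] -> //.
  by rewrite groupM // -aj groupX.
have jG' : j \in <<[set a; j * c]>> by rewrite -{1}aj groupX.
by rewrite -(groupMl c jG').
Qed.

(** * Two by two matrices by entries *)

Section Matrix2.

Variable R : comNzRingType.
Local Open Scope ring_scope.

Definition mx2 (a b c d : R) : 'M[R]_2 :=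
  \matrix_(i, j) if i == 0 then if j == 0 then a else b else if j == 0 then c else d.

Lemma mx2_eta (A : 'M[R]_2) : A = mx2 (A 0 0) (A 0 1) (A 1 0) (A 1 1).
Proof.
by apply/matrixP => i j; rewrite mxE; case: i j => [[|[|i]] // ?] [[|[|j]] // ?] /=;
  congr (A _ _); apply: val_inj.
Qed.

Lemma mx2M a b c d a' b' c' d' : mx2 a b c d *m mx2 a' b' c' d' =
  mx2 (a * a' + b * c') (a * b' + b * d') (c * a' + d * c') (c * b' + d * d').
Proof.
apply/matrixP => i j; rewrite !mxE !big_ord_recl big_ord0 !mxE addr0 /=.
by case: (i == 0); case: (j == 0).
Qed.

Lemma mx2D a b c d a' b' c' d' : mx2 a b c d + mx2 a' b' c' d' =
  mx2 (a + a') (b + b') (c + c') (d + d').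
Proof. by apply/matrixP => i j; rewrite !mxE; case: (i == 0); case: (j == 0). Qed.

Lemma scalar_mx2 a : a%:M = mx2 a 0 0 a.
Proof.
by apply/matrixP => i j; rewrite !mxE; case: i j => [[|[|i]] // ?] [[|[|j]] // ?].
Qed.

Lemma det_mx2 a b c d : \det (mx2 a b c d) = a * d - b * c.
Proof.
rewrite (expand_det_row _ ord0) !big_ord_recl big_ord0 addr0 /cofactor !det_mx11 !mxE /=.
by rewrite expr0 expr1 mul1r mulN1r mulrN.
Qed.

End Matrix2.

(** * Orders, generation and the two triples in SL(2, p) *)

Section SpecialLinear.

Variables (F : finFieldType) (p : nat).
Hypotheses (p_pr : prime p) (p_odd : odd p).
Hypotheses (charF : (p \in [pchar F])%R) (cardF : #|F| = p).
Hypothesis natF : forall x : F, exists n : nat, (n%:R = x)%R.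

Definition sl2_set : {set {'GL_2[F]}} := [set A | \det (GLval A) == 1]%R.

(** The default 1 is harmless: by [sl2E] it does not occur for determinant 1. *)
Definition sl2 (a b c d : F) : {'GL_2[F]} := insubd (1 : {'GL_2[F]}) (mx2 a b c d).

Arguments sl2 (a b c d)%_R.

Lemma GLval_inj : injective (GLval : {'GL_2[F]} -> 'M_2).
Proof. exact: val_inj. Qed.

Lemma sl2E a b c d : (a * d - b * c = 1)%R -> GLval (sl2 a b c d) = mx2 a b c d.
Proof.
move=> det1; have U : mx2 a b c d \in unitmx by rewrite unitmxE det_mx2 det1 unitr1.
by rewrite /sl2 -[GLval _]/(val _) val_insubd ifT.
Qed.

Lemma sl2_in a b c d : (a * d - b * c = 1)%R -> sl2 a b c d \in sl2_set.
Proof. by move=> det1; rewrite inE sl2E // det_mx2 det1. Qed.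

Lemma sl2P g : g \in sl2_set -> exists a b c d, (a * d - b * c = 1)%R /\ g = sl2 a b c d.
Proof.
rewrite inE => /eqP det_g.
have gE := mx2_eta (GLval g); have := det_g; rewrite gE det_mx2 => det1.
by do 4 eexists; split; [exact: det1 | apply: GLval_inj; rewrite sl2E].
Qed.

Lemma sl2M a b c d a' b' c' d' :
    (a * d - b * c = 1)%R -> (a' * d' - b' * c' = 1)%R ->
  sl2 a b c d * sl2 a' b' c' d' =
  (sl2 (a * a' + b * c') (a * b' + b * d') (c * a' + d * c') (c * b' + d * d'))%R.
Proof.
move=> det1 det1'; apply: GLval_inj.
rewrite GL_MxE !sl2E ?mx2M //.
transitivity ((a * d - b * c) * (a' * d' - b' * c'))%R; first by ring.
by rewrite det1 det1' mulr1.
Qed.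

Lemma sl2_1 : sl2 1 0 0 1 = 1.
Proof. by apply: GLval_inj; rewrite sl2E ?mulr1 ?mulr0 ?subr0 // -scalar_mx2. Qed.

Lemma sl2V a b c d : (a * d - b * c = 1)%R -> (sl2 a b c d)^-1 = sl2 d (- b) (- c) a.
Proof.
move=> det1; have detV : (d * a - - b * - c = 1)%R by rewrite -det1; ring.
apply: mulg1_eq; rewrite (sl2M det1 detV) -sl2_1 -det1.
by congr sl2; ring.
Qed.

Let two_neq0 : (2 != 0 :> F)%R.
Proof.
by rewrite -(dvdn_pcharf charF) dvdn_prime2 //; apply: contraTneq p_odd => ->.
Qed.

Lemma Fp_fermat (x : F) : (x ^+ p = x)%R.
Proof. by have := expf_card x; rewrite cardF. Qed.

Let p_half : p = (2 * p./2 + 1)%N.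
Proof. by rewrite -[p in LHS]odd_double_half p_odd add1n mul2n addn1. Qed.

(* B = 2 A - tr A squares to the scalar (tr A)^2 - 4, so the p-th power of A = (tr A + B)/2
   is read off from the Frobenius and from the quadratic character of (tr A)^2 - 4. *)
Lemma mx2_Frobenius (a b c d e : F) : (a * d - b * c = 1)%R ->
    (((a + d) ^+ 2 - 4) ^+ p./2 = e)%R -> (e ^+ 2 = 1)%R ->
  (mx2 a b c d ^+ p = if e == 1 then mx2 a b c d else mx2 d (- b) (- c) a)%R.
Proof.
move=> det1 chi_e e2.
pose A := mx2 a b c d; pose B : 'M[F]_2 := mx2 (a - d) (2 * b) (2 * c) (d - a).
have chM : (p \in [pchar 'M[F]_2])%R.
  rewrite inE p_pr /= -scaler_nat (pcharf0 charF) scale0r //.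
have AE : (2%:M * A = (a + d)%:M + B)%R.
  rewrite !scalar_mx2 [LHS]mx2M mx2D /B /=.
  by congr mx2; ring.
have B2 : (B * B = ((a + d) ^+ 2 - 4)%:M)%R.
  have D : ((a + d) ^+ 2 - 4 = (a + d) ^+ 2 - 4 * (a * d - b * c))%R by rewrite det1 mulr1.
  by rewrite scalar_mx2 [LHS]mx2M D; congr mx2; ring.
have Bp : (B ^+ p = e%:M * B)%R.
  transitivity (B ^+ (2 * p./2 + 1))%R; first by congr (_ ^+ _)%R.
  by rewrite exprD expr1 exprM expr2 B2 -rmorphXn chi_e.
have Ap : (2%:M * A ^+ p = (a + d)%:M + e%:M * B)%R.
  rewrite -[in LHS](Fp_fermat 2%R) rmorphXn -exprMn_comm; last exact: esym (scalar_mxC _ _).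
  rewrite AE -[LHS](pFrobenius_autE chM) pFrobenius_autD_comm; last exact: esym (scalar_mxC _ _).
  by rewrite !pFrobenius_autE Bp -rmorphXn Fp_fermat.
have two_inj : injective (fun X : 'M[F]_2 => 2%:M * X)%R.
  move=> X Y /(congr1 (fun Z => (2^-1)%:M * Z))%R.
  by rewrite !mulrA -!rmorphM mulVf // rmorph1 !mul1r.
suffices H : (2%:M * A ^+ p = 2%:M * if e == 1 then A else mx2 d (- b) (- c) a)%R.
  exact: two_inj H.
rewrite Ap; move/eqP: e2; rewrite sqrf_eq1; have [->|_ /eqP->] := eqVneq e 1%R.
  by rewrite rmorph1 mul1r -AE.
by rewrite !scalar_mx2 [RHS]mx2M [(_ * B)%R]mx2M mx2D; congr mx2; ring.
Qed.

Lemma GLvalX (g : {'GL_2[F]}) n : GLval (g ^+ n) = (GLval g ^+ n)%R.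
Proof. by elim: n => // n IHn; rewrite expgS GL_ME IHn exprS. Qed.

Lemma sl2_pow (a b c d e : F) : (a * d - b * c = 1)%R ->
    (((a + d) ^+ 2 - 4) ^+ p./2 = e)%R -> (e ^+ 2 = 1)%R ->
  sl2 a b c d ^+ (if e == 1%R then p.-1 else p.+1) = 1.
Proof.
move=> det1 chi_e e2; set g := sl2 a b c d.
have : g ^+ p = if e == 1%R then g else g^-1.
  have detV : (d * a - - b * - c = 1)%R by rewrite -det1; ring.
  apply: GLval_inj; rewrite GLvalX (sl2E det1) (mx2_Frobenius det1 chi_e e2) /g (sl2V det1).
  by case: ifP => _; rewrite sl2E.
case: ifP => _ gp; last by rewrite expgS gp mulgV.
by apply: (mulgI g); rewrite -expgS prednK ?prime_gt0 // gp mulg1.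
Qed.

(** With p = eps modulo 4 these are p - eps and the odd number (p + eps)/2. The word split refers to
    4 - t^2 being a nonzero square, rather than to the discriminant t^2 - 4. *)
Definition split_order := if (p %% 4 == 1)%N then p.-1 else p.+1.
Definition nonsplit_half_order := (if (p %% 4 == 1)%N then p.+1 else p.-1)./2.

Let neg1_neq1 : (-1 == 1 :> F)%R = false.
Proof. by apply/negbTE; rewrite eq_sym -subr_eq0 opprK -[(1 + 1)%R]/(2%:R)%R two_neq0. Qed.

(** As p is odd, [p./2] is (p - 1)/2, and the power [x ^+ p./2] serves throughout as the quadratic
    character of x. *)
Lemma sqr_char (x : F) : (x != 0 -> (x ^+ 2) ^+ p./2 = 1)%R.
Proof.
move=> x0; apply: (mulfI x0); rewrite mulr1 -exprM -exprS -addn1 -p_half.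
exact: Fp_fermat.
Qed.

Lemma neg1_char : ((-1) ^+ p./2 = if (p %% 4 == 1)%N then 1 else -1 :> F)%R.
Proof.
have -> : (p %% 4 == 1)%N = ~~ odd p./2.
  by have := p_half; have := odd_double_half p./2; rewrite -mul2n; case: odd; lia.
by rewrite -signr_odd; case: odd.
Qed.

Lemma sl2_order_square (a b c d : F) :
    (a * d - b * c = 1)%R -> ((4 - (a + d) ^+ 2) ^+ p./2 = 1)%R ->
  sl2 a b c d ^+ split_order = 1.
Proof.
move=> det1 tE.
have chi_e : (((a + d) ^+ 2 - 4) ^+ p./2 = if (p %% 4 == 1)%N then 1 else -1)%R.
  have -> : ((a + d) ^+ 2 - 4 = -1 * (4 - (a + d) ^+ 2))%R by ring.
  by rewrite exprMn tE neg1_char mulr1.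
have := sl2_pow det1 chi_e; rewrite /split_order.
by case: ifP => _; rewrite ?eqxx ?neg1_neq1; apply; rewrite ?sqrrN expr1n.
Qed.

Lemma sl2_order_nonsquare (a b c d : F) :
    (a * d - b * c = 1)%R -> ((4 - (a + d) ^+ 2) ^+ p./2 = -1)%R ->
  sl2 a b c d ^+ (2 * nonsplit_half_order) = 1.
Proof.
move=> det1 tE.
have chi_e : (((a + d) ^+ 2 - 4) ^+ p./2 = if (p %% 4 == 1)%N then -1 else 1)%R.
  transitivity ((-1) ^+ p./2 * (4 - (a + d) ^+ 2) ^+ p./2)%R.
    have -> : ((a + d) ^+ 2 - 4 = -1 * (4 - (a + d) ^+ 2))%R by ring.
    by rewrite exprMn.
  by rewrite tE neg1_char; case: ifP => _; ring.
have -> : (2 * nonsplit_half_order = if (p %% 4 == 1)%N then p.+1 else p.-1)%N.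
  by rewrite /nonsplit_half_order; have := p_half; case: ifP => _; lia.
have := sl2_pow det1 chi_e.
by case: ifP => _; rewrite ?eqxx ?neg1_neq1; apply; rewrite ?sqrrN expr1n.
Qed.

(** Otherwise all p - 1 nonzero elements would be roots of X^((p - 1)/2) - 1. *)
Lemma exists_nonsquare : exists x : F, (x ^+ p./2 = -1)%R.
Proof.
have [x|no_x] := pickP (fun x : F => x ^+ p./2 == -1)%R; first by move/eqP; exists x.
have p_gt2 : (2 < p)%N by rewrite ltn_neqAle prime_gt1 // andbT; apply: contraTneq p_odd => <-.
have rootsP : all (root ('X^(p./2) - 1%:P)%R) (enum (predC1 (0%R : F))).
  apply/allP=> x; rewrite mem_enum !inE => x0.
  rewrite rootE !hornerE subr_eq0; have := sqr_char x0.
  by rewrite -exprM mulnC exprM => /eqP; rewrite sqrf_eq1 no_x orbF.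
have := max_poly_roots _ rootsP (enum_uniq _).
rewrite -cardE cardC1 cardF -size_poly_eq0 size_XnsubC; last by have := p_half; lia.
by move=> /(_ isT); have := p_half; lia.
Qed.

(** For a nonsquare n the conic 4 - t^2 = n x^2 passes through t = 2, x = 0. The line t = 2 + k x
    meets it again at x = -4k/(k^2 + n); the slope is k = 1, or k = 2 if n = -1. *)
Lemma exists_sub_sqr_nonsquare : p != 3 -> exists t : F, ((4 - t ^+ 2) ^+ p./2 = -1)%R.
Proof.
move=> p3; have [n chi_n] := exists_nonsquare.
have three_neq0 : (3 != 0 :> F)%R.
  by rewrite -(dvdn_pcharf charF) dvdn_prime2.
have [k k0 kn0] : exists2 k : F, (k != 0)%R & (k ^+ 2 + n != 0)%R.
  have [n1|n1] := eqVneq (1 + n)%R 0%R; last by exists 1%R; rewrite ?oner_eq0 ?expr1n.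
  exists 2%R => //; have -> : (2 ^+ 2 + n = 3 + (1 + n) :> F)%R by ring.
  by rewrite n1 addr0.
pose x := (- 4 * k / (k ^+ 2 + n))%R.
have x0 : (x != 0)%R.
  rewrite !mulf_eq0 invr_eq0 !negb_or k0 kn0 oppr_eq0 !andbT.
  by rewrite (natrM F 2 2) mulf_neq0.
exists (2 + k * x)%R; have -> : (4 - (2 + k * x) ^+ 2 = n * x ^+ 2)%R.
  by rewrite /x; field.
by rewrite exprMn sqr_char // chi_n mulr1.
Qed.

Lemma sl2_upper_exp (x : F) n : sl2 1 x 0 1 ^+ n = sl2 1 (x *+ n) 0 1.
Proof.
elim: n => [|n IHn]; first by rewrite mulr0n sl2_1.
rewrite expgS IHn sl2M ?mulr0 ?subr0 ?mulr1 //.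
by congr sl2; rewrite ?mulrS; ring.
Qed.

Lemma sl2_lower_exp (x : F) n : sl2 1 0 x 1 ^+ n = sl2 1 0 (x *+ n) 1.
Proof.
elim: n => [|n IHn]; first by rewrite mulr0n sl2_1.
rewrite expgS IHn sl2M ?mul0r ?subr0 ?mulr1 //.
by congr sl2; rewrite ?mulrS; ring.
Qed.

Let mulrn_div (s x : F) : (s != 0)%R -> exists n : nat, (s *+ n = x)%R.
Proof.
by move=> s0; have [n nE] := natF (x / s)%R; exists n; rewrite -mulr_natl nE divfK.
Qed.

(** Powers of one upper transvection give all of them. A matrix with nonzero lower left entry c is
    upper times lower times upper transvection, the middle one having entry c; so g yields a lower
    transvection and then all. *)
Lemma sl2_sub_gen (K : {group {'GL_2[F]}}) (s a b c d : F) :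
    (s != 0)%R -> (c != 0)%R -> (a * d - b * c = 1)%R ->
    sl2 1 s 0 1 \in K -> sl2 a b c d \in K ->
  sl2_set \subset K.
Proof.
move=> s0 c0 det1 sK gK.
have UK x : sl2 1 x 0 1 \in K.
  by have [n <-] := mulrn_div x s0; rewrite -sl2_upper_exp groupX.
have decomp a' b' c' d' : (c' != 0)%R -> (a' * d' - b' * c' = 1)%R ->
    sl2 a' b' c' d' = sl2 1 ((a' - 1) / c') 0 1 * sl2 1 0 c' 1 * sl2 1 ((d' - 1) / c') 0 1.
  move=> c0' det1'.
  have -> : b' = ((a' * d' - 1) / c')%R by rewrite -det1'; field.
  by rewrite !sl2M; try ring; congr sl2; field.
have cK : sl2 1 0 c 1 \in K.
  by move: gK; rewrite (decomp _ _ _ _ c0 det1) groupMr // groupMl.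
have LK x : sl2 1 0 x 1 \in K.
  by have [n <-] := mulrn_div x c0; rewrite -sl2_lower_exp groupX.
apply/subsetP=> g /sl2P[a' [b' [c' [d' [det1' ->]]]]].
have [c0'|c0'] := eqVneq c' 0%R; last by rewrite decomp // !groupM.
have a0' : (a' != 0)%R.
  by apply: contra_eq_neq det1' => ->; rewrite c0' mul0r mulr0 subr0 eq_sym oner_neq0.
(* For c' = 0, multiplying on the left by a lower transvection makes the lower left entry a', which
   is nonzero. *)
have detL : (1 * 1 - 0 * 1 = 1 :> F)%R by ring.
rewrite -(groupMl _ (LK 1%R)) (sl2M detL det1') decomp ?groupM // c0' ?mul1r ?addr0 //.
by rewrite -det1' c0'; ring.
Qed.

Lemma sl2_gen_odd_order : sl2_set \subset <<[set g in sl2_set | odd #[g]]>>.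
Proof.
have odd1 (g : {'GL_2[F]}) : g ^+ p = 1 -> odd #[g].
  by move=> gp; apply: dvdn_odd p_odd; rewrite order_dvdn gp.
have pF0 : (1 *+ p = 0 :> F)%R by apply: pcharf0 charF.
apply: (@sl2_sub_gen _ 1%R 1%R 0%R 1%R 1%R); rewrite ?oner_neq0 ?mul0r ?subr0 ?mulr1 //.
  rewrite mem_gen // inE sl2_in ?odd1 //=; last by ring.
  by rewrite sl2_upper_exp pF0 sl2_1.
rewrite mem_gen // inE sl2_in ?odd1 //=; last by ring.
by rewrite sl2_lower_exp pF0 sl2_1.
Qed.

Definition is_split (g : {'GL_2[F]}) : Prop :=
  g \in sl2_set /\ ((4 - (\tr (GLval g)) ^+ 2) ^+ p./2 = 1)%R.

Lemma mxtrace_sl2 a b c d : (a * d - b * c = 1 -> \tr (GLval (sl2 a b c d)) = a + d)%R.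
Proof. by move=> det1; rewrite sl2E // /mxtrace !big_ord_recl big_ord0 !mxE addr0. Qed.

Lemma sl2_is_split a b c d : (a * d - b * c = 1)%R ->
  ((4 - (a + d) ^+ 2) ^+ p./2 = 1)%R -> is_split (sl2 a b c d).
Proof. by move=> det1; split; rewrite ?sl2_in // mxtrace_sl2. Qed.

Lemma is_split_order g : is_split g -> g ^+ split_order = 1.
Proof.
case=> /sl2P[a [b [c [d [det1 ->]]]]]; rewrite mxtrace_sl2 //.
exact: sl2_order_square.
Qed.

Let J := sl2 (-1) 0 0 (-1).

Let detJ : (-1 * -1 - 0 * 0 = 1 :> F)%R. Proof. by ring. Qed.

Let JM a b c d : (a * d - b * c = 1)%R -> J * sl2 a b c d = sl2 (- a) (- b) (- c) (- d).
Proof. by move=> det1; rewrite (sl2M detJ det1); congr sl2; ring. Qed.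

Let JC g : g \in sl2_set -> commute J g.
Proof.
case/sl2P=> a [b [c [d [det1 ->]]]]; rewrite /commute JM //.
by rewrite (sl2M det1 detJ); congr sl2; ring.
Qed.

Let J2 : J ^+ 2 = 1.
Proof. by rewrite expg2 JM // !opprK oppr0 sl2_1. Qed.

Let J_neq1 : J != 1.
Proof.
apply/eqP=> /(congr1 (fun g => GLval g 0%R 0%R)); rewrite sl2E // !mxE /= => /eqP.
by rewrite neg1_neq1.
Qed.

Let is_splitJ g : is_split g -> is_split (J * g).
Proof.
case=> /sl2P[a [b [c [d [det1 ->]]]]]; rewrite mxtrace_sl2 // => chi_t; rewrite JM //.
have det1' : (- a * - d - - b * - c = 1)%R by rewrite -det1; ring.
apply: sl2_is_split => //.
by have -> : (4 - (- a + - d) ^+ 2 = 4 - (a + d) ^+ 2)%R by ring.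
Qed.

Definition even_pair_for (K : {set {'GL_2[F]}}) : Prop :=
  exists a c, [/\ ~~ odd #[a] /\ ~~ odd #[c], a ^+ split_order = 1,
    c ^+ split_order = 1, (a * c) ^+ split_order = 1 & <<[set a; c]>> = K].

(* Since -1 is a power of a, replacing c by -c changes neither the group nor the split orders. *)
Lemma split_pair (K : {group {'GL_2[F]}}) (a c : {'GL_2[F]}) i (s x y z w : F) :
    K :=: sl2_set -> is_split a -> is_split c -> is_split (a * c) -> a ^+ i = J ->
    (s != 0)%R -> sl2 1 s 0 1 \in <<[set a; c]>> ->
    (z != 0)%R -> (x * w - y * z = 1)%R -> c = sl2 x y z w ->
  even_pair_for K.
Proof.
move=> KE split_a split_c split_ac aJ s0 sG z0 det1 cE.
have genK : <<[set a; c]>> = K.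
  apply/eqP; rewrite eqEsubset gen_subG; apply/andP; split.
    by apply/subsetP=> g /set2P[] ->; rewrite KE; [case: split_a | case: split_c].
  rewrite KE; apply: (sl2_sub_gen s0 z0 det1 sG).
  by rewrite -cE mem_gen // !inE eqxx orbT.
have aC : a * (J * c) = J * (a * c).
  by rewrite mulgA -(JC (proj1 split_a)) -mulgA.
have [even_a [c' [c'E even_c' gen']]] := even_order_choice J2 J_neq1 (JC (proj1 split_c)) aJ.
have [sc' sac'] : is_split c' /\ is_split (a * c').
  case: c'E => ->; first by split.
  by rewrite aC; split; apply: is_splitJ.
exists a, c'; split; [by split | exact: is_split_order | exact: is_split_order | exact: is_split_order |].
by rewrite gen' genK.
Qed.

Let chi_sqr_mul (x y : F) : (x != 0 -> (x ^+ 2 * y) ^+ p./2 = y ^+ p./2)%R.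
Proof. by move=> x0; rewrite exprMn sqr_char // mul1r. Qed.

Let trace0_J a b c d : (a * d - b * c = 1)%R -> (a + d = 0)%R -> sl2 a b c d ^+ 2 = J.
Proof.
move=> det1 /eqP; rewrite addr_eq0 => /eqP aE; rewrite expg2 sl2M //.
by move: det1; rewrite aE /J => <-; congr sl2; ring.
Qed.

Let trace0_split a b c d : (a * d - b * c = 1)%R -> (a + d = 0)%R -> is_split (sl2 a b c d).
Proof.
move=> det1 tr0; apply: sl2_is_split => //; rewrite tr0.
have -> : (4 - 0 ^+ 2 = 2 ^+ 2 :> F)%R by ring.
exact: sqr_char.
Qed.

(* tr c = t and a c^2 = (1 1; 0 1), with tr a = 0 and tr (a c) = 2/t. *)
Lemma even_pair_trace2 (K : {group {'GL_2[F]}}) (t : F) : K :=: sl2_set ->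
    (t != 0)%R -> (t ^+ 2 - 2 != 0)%R ->
    ((4 - t ^+ 2) ^+ p./2 = 1)%R -> ((t ^+ 2 - 1) ^+ p./2 = 1)%R ->
  even_pair_for K.
Proof.
move=> KE t0 t2 chi4 chi1.
have deta : (1 * -1 - 2 / (t ^+ 2 - 2) * (2 - t ^+ 2) = 1)%R by field; rewrite ?t0 ?t2.
have detc : (0 * t - (- t / (t ^+ 2 - 2)) * ((t ^+ 2 - 2) / t) = 1)%R by field; rewrite ?t0 ?t2.
pose a := sl2 1 (2 / (t ^+ 2 - 2)) (2 - t ^+ 2) (-1).
pose c := sl2 0 (- t / (t ^+ 2 - 2)) ((t ^+ 2 - 2) / t) t.
have acE : a * c = (sl2 (2 / t) (t / (t ^+ 2 - 2)) (- (t ^+ 2 - 2) / t) 0)%R.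
  by rewrite (sl2M deta detc); congr sl2; field; rewrite ?t0 ?t2.
have detac : (2 / t * 0 - t / (t ^+ 2 - 2) * (- (t ^+ 2 - 2) / t) = 1)%R by field; rewrite ?t0 ?t2.
have ac2E : a * c * c = sl2 1 1 0 1.
  by rewrite acE (sl2M detac detc); congr sl2; field; rewrite ?t0 ?t2.
have tr_a : (1 + -1 = 0 :> F)%R by ring.
have split_a : is_split a by apply: trace0_split.
have split_c : is_split c by apply: sl2_is_split; rewrite ?add0r.
have split_ac : is_split (a * c).
  rewrite acE; apply: sl2_is_split => //.
  have -> : (4 - (2 / t + 0) ^+ 2 = (2 / t) ^+ 2 * (t ^+ 2 - 1))%R by field; rewrite ?t0 ?t2.
  by rewrite chi_sqr_mul // mulf_neq0 ?invr_eq0.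
apply: (split_pair KE split_a split_c split_ac (trace0_J deta tr_a) (oner_neq0 F) _ _ detc (erefl c)).
  by rewrite -ac2E !groupM // mem_gen // !inE eqxx ?orbT.
by rewrite mulf_neq0 ?invr_eq0.
Qed.

(* tr c = t and a c^3 = (1 1; 0 1), with tr a = 0 and tr (a c) = 2/(t^2 - 1). *)
Lemma even_pair_trace3 (K : {group {'GL_2[F]}}) (t : F) : K :=: sl2_set ->
    (t != 0)%R -> (t ^+ 2 - 1 != 0)%R -> (t ^+ 2 - 3 != 0)%R ->
    ((4 - t ^+ 2) ^+ p./2 = 1)%R -> ((t ^+ 2 - 2) ^+ p./2 = 1)%R ->
  even_pair_for K.
Proof.
move=> KE t0 t1 t3 chi4 chi2.
have deta : (t * - t - (t ^+ 2 + 1) / (t * (t ^+ 2 - 3)) * (- t * (t ^+ 2 - 3)) = 1)%R.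
  by field; rewrite ?t0 ?t3.
have detc : (0 * t - (- (t ^+ 2 - 1) / (t * (t ^+ 2 - 3))) * (t * (t ^+ 2 - 3) / (t ^+ 2 - 1)) = 1)%R.
  by field; rewrite ?t0 ?t1 ?t3.
pose a := sl2 t ((t ^+ 2 + 1) / (t * (t ^+ 2 - 3))) (- t * (t ^+ 2 - 3)) (- t).
pose c := sl2 0 (- (t ^+ 2 - 1) / (t * (t ^+ 2 - 3))) (t * (t ^+ 2 - 3) / (t ^+ 2 - 1)) t.
have acE : a * c = (sl2 ((t ^+ 2 + 1) / (t ^+ 2 - 1)) (2 / (t ^+ 2 - 3))
    (- t ^+ 2 * (t ^+ 2 - 3) / (t ^+ 2 - 1)) (-1))%R.
  by rewrite (sl2M deta detc); congr sl2; field; rewrite ?t0 ?t1 ?t3.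
have detac : ((t ^+ 2 + 1) / (t ^+ 2 - 1) * -1
    - 2 / (t ^+ 2 - 3) * (- t ^+ 2 * (t ^+ 2 - 3) / (t ^+ 2 - 1)) = 1)%R.
  by field; rewrite ?t1 ?t3.
have ac2E : a * c * c = (sl2 (2 * t / (t ^+ 2 - 1)) ((t ^+ 2 - 1) / (t * (t ^+ 2 - 3)))
    (- t * (t ^+ 2 - 3) / (t ^+ 2 - 1)) 0)%R.
  by rewrite acE (sl2M detac detc); congr sl2; field; rewrite ?t0 ?t1 ?t3.
have detac2 : (2 * t / (t ^+ 2 - 1) * 0
    - (t ^+ 2 - 1) / (t * (t ^+ 2 - 3)) * (- t * (t ^+ 2 - 3) / (t ^+ 2 - 1)) = 1)%R.
  by field; rewrite ?t0 ?t1 ?t3.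
have ac3E : a * c * c * c = sl2 1 1 0 1.
  by rewrite ac2E (sl2M detac2 detc); congr sl2; field; rewrite ?t0 ?t1 ?t3.
have tr_a : (t + - t = 0)%R by ring.
have split_a : is_split a by apply: trace0_split.
have split_c : is_split c by apply: sl2_is_split; rewrite ?add0r.
have split_ac : is_split (a * c).
  rewrite acE; apply: sl2_is_split => //.
  have -> : (4 - ((t ^+ 2 + 1) / (t ^+ 2 - 1) + -1) ^+ 2
      = (2 * t / (t ^+ 2 - 1)) ^+ 2 * (t ^+ 2 - 2))%R by field; rewrite ?t1.
  by rewrite chi_sqr_mul // !mulf_neq0 ?invr_eq0.
apply: (split_pair KE split_a split_c split_ac (trace0_J deta tr_a) (oner_neq0 F) _ _ detc (erefl c)).
  by rewrite -ac3E !groupM // mem_gen // !inE eqxx ?orbT.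
by rewrite !mulf_neq0 ?invr_eq0.
Qed.

Let chi_or (x : F) : (x != 0)%R -> (x ^+ p./2 = 1)%R \/ (x ^+ p./2 = -1)%R.
Proof.
move/sqr_char; rewrite -exprM mulnC exprM => /eqP.
by rewrite sqrf_eq1 => /orP[] /eqP; [left | right].
Qed.

Lemma natr_neq0 m : all (fun q => p != q) (primes m) -> 0 < m -> (m%:R != 0 :> F)%R.
Proof.
move=> pm m_gt0; rewrite -(dvdn_pcharf charF); apply/negP=> p_m.
have /(allP pm) : p \in primes m by rewrite mem_primes p_pr m_gt0.
by rewrite eqxx.
Qed.

(** The Pythagorean triples 3, 4, 5 and 7, 24, 25 make 4 - t^2 a square. Up to squares t^2 - 1 is 11
    for t = 6/5, 39 for t = 8/5 and -11 * 39 for t = -14/25; if the first two are nonsquares the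
    third is a square, as -1 is one. *)
Lemma even_pair_mod4_1 (K : {group {'GL_2[F]}}) : K :=: sl2_set ->
  (p %% 4 = 1)%N -> p \notin [:: 5; 13; 17] -> even_pair_for K.
Proof.
move=> KE p4 pn.
have nz m : all (fun q => (q \in [:: 5; 13; 17]) || (q %% 4 != 1)%N) (primes m) -> 0 < m ->
    (m%:R != 0 :> F)%R.
  move=> /allP qm; apply: natr_neq0; apply/allP=> q /qm.
  by apply: contraLR; rewrite negbK => /eqP<-; rewrite negb_or pn p4.
have [n5 n6 n8] := And3 (nz 5 isT isT) (nz 6 isT isT) (nz 8 isT isT).
have [n11 n14 n39] := And3 (nz 11 isT isT) (nz 14 isT isT) (nz 39 isT isT).
have [n25 n48 n1054] := And3 (nz 25 isT isT) (nz 48 isT isT) (nz 1054 isT isT).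
have n625 := nz 625 isT isT.
have divn0 (x y : F) : (x != 0 -> y != 0 -> x / y != 0)%R.
  by move=> x0 y0; rewrite mulf_neq0 ?invr_eq0.
have [chi11|chi11] := chi_or n11.
  apply: (@even_pair_trace2 K (6 / 5)%R KE); first exact: divn0.
  - have -> : ((6 / 5) ^+ 2 - 2 = - (14 / 25) :> F)%R by field; rewrite ?n5 ?n25 ?n625.
    by rewrite oppr_eq0 divn0.
  - have -> : (4 - (6 / 5) ^+ 2 = (8 / 5) ^+ 2 :> F)%R by field; rewrite ?n5 ?n25 ?n625.
    by rewrite sqr_char // divn0.
  - have -> : ((6 / 5) ^+ 2 - 1 = (1 / 5) ^+ 2 * 11 :> F)%R by field; rewrite ?n5 ?n25 ?n625.
    by rewrite chi_sqr_mul ?divn0 ?oner_neq0.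
have [chi39|chi39] := chi_or n39.
  apply: (@even_pair_trace2 K (8 / 5)%R KE); first exact: divn0.
  - have -> : ((8 / 5) ^+ 2 - 2 = 14 / 25 :> F)%R by field; rewrite ?n5 ?n25 ?n625.
    by rewrite divn0.
  - have -> : (4 - (8 / 5) ^+ 2 = (6 / 5) ^+ 2 :> F)%R by field; rewrite ?n5 ?n25 ?n625.
    by rewrite sqr_char // divn0.
  - have -> : ((8 / 5) ^+ 2 - 1 = (1 / 5) ^+ 2 * 39 :> F)%R by field; rewrite ?n5 ?n25 ?n625.
    by rewrite chi_sqr_mul ?divn0 ?oner_neq0.
apply: (@even_pair_trace2 K (- (14 / 25))%R KE); first by rewrite oppr_eq0 divn0.
- have -> : ((- (14 / 25)) ^+ 2 - 2 = - (1054 / 625) :> F)%R by field; rewrite ?n5 ?n25 ?n625.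
  by rewrite oppr_eq0 divn0.
- have -> : (4 - (- (14 / 25)) ^+ 2 = (48 / 25) ^+ 2 :> F)%R by field; rewrite ?n5 ?n25 ?n625.
  by rewrite sqr_char // divn0.
have -> : ((- (14 / 25)) ^+ 2 - 1 = (1 / 25) ^+ 2 * (-1 * (11 * 39)) :> F)%R by field; rewrite ?n5 ?n25 ?n625.
rewrite chi_sqr_mul ?divn0 ?oner_neq0 // exprMn neg1_char p4 eqxx mul1r exprMn chi11 chi39.
by rewrite mulrNN mulr1.
Qed.

(** Up to squares t^2 - 2 is 14 for t = 8/5 and -14 for t = 6/5; as -1 is a nonsquare, one of the
    two is a square. *)
Lemma even_pair_mod4_3 (K : {group {'GL_2[F]}}) : K :=: sl2_set ->
  (p %% 4 = 3)%N -> p \notin [:: 3; 7; 11] -> even_pair_for K.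
Proof.
move=> KE p4 pn.
have nz m : all (fun q => (q \in [:: 3; 7; 11]) || (q %% 4 != 3)%N) (primes m) -> 0 < m ->
    (m%:R != 0 :> F)%R.
  move=> /allP qm; apply: natr_neq0; apply/allP=> q /qm.
  by apply: contraLR; rewrite negbK => /eqP<-; rewrite negb_or pn p4.
have [n5 n6 n8] := And3 (nz 5 isT isT) (nz 6 isT isT) (nz 8 isT isT).
have [n11 n14 n39] := And3 (nz 11 isT isT) (nz 14 isT isT) (nz 39 isT isT).
have n25 := nz 25 isT isT.
have divn0 (x y : F) : (x != 0 -> y != 0 -> x / y != 0)%R.
  by move=> x0 y0; rewrite mulf_neq0 ?invr_eq0.
have [chi14|chi14] := chi_or n14.
  apply: (@even_pair_trace3 K (8 / 5)%R KE); first exact: divn0.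
  - have -> : ((8 / 5) ^+ 2 - 1 = 39 / 25 :> F)%R by field; rewrite ?n5 ?n25.
    by rewrite divn0.
  - have -> : ((8 / 5) ^+ 2 - 3 = - (11 / 25) :> F)%R by field; rewrite ?n5 ?n25.
    by rewrite oppr_eq0 divn0.
  - have -> : (4 - (8 / 5) ^+ 2 = (6 / 5) ^+ 2 :> F)%R by field; rewrite ?n5 ?n25.
    by rewrite sqr_char // divn0.
  - have -> : ((8 / 5) ^+ 2 - 2 = (1 / 5) ^+ 2 * 14 :> F)%R by field; rewrite ?n5 ?n25.
    by rewrite chi_sqr_mul ?divn0 ?oner_neq0.
apply: (@even_pair_trace3 K (6 / 5)%R KE); first exact: divn0.
- have -> : ((6 / 5) ^+ 2 - 1 = 11 / 25 :> F)%R by field; rewrite ?n5 ?n25.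
  by rewrite divn0.
- have -> : ((6 / 5) ^+ 2 - 3 = - (39 / 25) :> F)%R by field; rewrite ?n5 ?n25.
  by rewrite oppr_eq0 divn0.
- have -> : (4 - (6 / 5) ^+ 2 = (8 / 5) ^+ 2 :> F)%R by field; rewrite ?n5 ?n25.
  by rewrite sqr_char // divn0.
have -> : ((6 / 5) ^+ 2 - 2 = (1 / 5) ^+ 2 * (-1 * 14) :> F)%R by field; rewrite ?n5 ?n25.
rewrite chi_sqr_mul ?divn0 ?oner_neq0 // exprMn neg1_char p4 chi14.
by rewrite mulrNN mulr1.
Qed.

(** Reduces equality modulo p to a [ring] identity; the quotient k is supplied at each use. *)
Let modp (k x y : F) : (x = y + p%:R * k -> x = y)%R.
Proof. by rewrite (pcharf0 charF) mul0r addr0. Qed.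

(** The traces of a, c, a c are 3, 3, 4, for which 4 - t^2 = 3^2 modulo 7; moreover a^4 = -1 and a^2
    c is a transvection. *)
Lemma even_pair_7 (K : {group {'GL_2[F]}}) : K :=: sl2_set -> p = 7 -> even_pair_for K.
Proof.
move=> KE p7; have mod7 (k x y : F) : (x = y + 7 * k -> x = y)%R by rewrite -p7; apply: modp.
have nz m : all (fun q => q != 7) (primes m) -> 0 < m -> (m%:R != 0 :> F)%R.
  by move=> qm; apply: natr_neq0; apply: sub_all qm => q; rewrite p7 eq_sym.
have deta : (0 * 3 - 1 * -1 = 1 :> F)%R by ring.
have detc : (1 * 2 - 5 * 3 = 1 :> F)%R by apply: (mod7 (-2)%R); ring.
pose a := sl2 0 1 (-1) 3; pose c := sl2 1 5 3 2.
have a2E : a * a = sl2 (-1) 3 (-3) 1.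
  by rewrite (sl2M deta deta); congr sl2; [ring | ring | ring | apply: (mod7 1%R); ring].
have deta2 : (-1 * 1 - 3 * -3 = 1 :> F)%R by apply: (mod7 1%R); ring.
have acE : a * c = sl2 3 2 1 1.
  by rewrite (sl2M deta detc); congr sl2; [ring | ring | apply: (mod7 1%R); ring | ring].
have aJ : a ^+ 4 = J.
  rewrite (expgM a 2 2) !expg2 a2E (sl2M deta2 deta2).
  by congr sl2; [apply: (mod7 (-1)%R) | | | apply: (mod7 (-1)%R)]; ring.
have a2cE : a * a * c = sl2 1 1 0 1.
  rewrite a2E (sl2M deta2 detc); congr sl2; [apply: (mod7 1%R) | apply: (mod7 0%R) | | apply: (mod7 (-2)%R)]; ring.
have split_of (x y z w r : F) : (x * w - y * z = 1)%R -> (r != 0)%R ->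
    (4 - (x + w) ^+ 2 = r ^+ 2)%R -> is_split (sl2 x y z w).
  by move=> det1 r0 E; apply: sl2_is_split => //; rewrite E sqr_char.
have split_a : is_split a by apply: (split_of _ _ _ _ 3%R); rewrite ?nz //; apply: (mod7 (-2)%R); ring.
have split_c : is_split c by apply: (split_of _ _ _ _ 3%R); rewrite ?nz //; apply: (mod7 (-2)%R); ring.
have split_ac : is_split (a * c).
  by rewrite acE; apply: (split_of _ _ _ _ 3%R); rewrite ?nz //; [ring | apply: (mod7 (-3)%R); ring].
apply: (split_pair KE split_a split_c split_ac aJ (oner_neq0 F) _ _ detc (erefl c)).
  by rewrite -a2cE !groupM // mem_gen // !inE eqxx ?orbT.
exact: nz.
Qed.

(** The transvections are chosen with a c of trace 2 + s = t^2 - 2. Then a c is the square of an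
    element of trace t, with 4 - t^2 a nonsquare, and so its order divides the odd half order. *)
Lemma sl2_odd_pair (K : {group {'GL_2[F]}}) : K :=: sl2_set -> p != 3 ->
  exists a c, [/\ a ^+ (p * nonsplit_half_order) = 1, c ^+ (p * nonsplit_half_order) = 1,
    (a * c) ^+ (p * nonsplit_half_order) = 1 & <<[set a; c]>> = K].
Proof.
move=> KE p3; have [t chi_t] := exists_sub_sqr_nonsquare p3.
have pF0 (x : F) : (x *+ p = 0)%R by rewrite -mulr_natl (pcharf0 charF) mul0r.
have half_gt0 : (0 < p./2)%N by have := p_half; have := prime_gt1 p_pr; clear; lia.
have t0 : (t != 0)%R.
  apply: contra_eq_neq chi_t => ->.
  have -> : (4 - 0 ^+ 2 = 2 ^+ 2 :> F)%R by ring.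
  by rewrite sqr_char // eq_sym neg1_neq1.
pose s := (t ^+ 2 - 4)%R.
have s0 : (s != 0)%R.
  rewrite -oppr_eq0 opprB; apply: contra_eq_neq chi_t => ->.
  by rewrite expr0n eqn0Ngt half_gt0 /= eq_sym oppr_eq0 oner_neq0.
have detU : (1 * 1 - 1 * 0 = 1 :> F)%R by ring.
have detL : (1 * 1 - 0 * s = 1 :> F)%R by ring.
have detP : ((1 + s) * 1 - 1 * s = 1)%R by ring.
pose a := sl2 1 1 0 1; pose c := sl2 1 0 s 1.
have acE : a * c = sl2 (1 + s) 1 s 1 by rewrite (sl2M detU detL); congr sl2; ring.
(* By Cayley-Hamilton a square root R of a c with trace t and determinant 1 satisfies t R = a c +
   1. *)
have detR : ((2 + s) / t * (2 / t) - 1 / t * (s / t) = 1)%R by rewrite /s; field.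
have acR : a * c = (sl2 ((2 + s) / t) (1 / t) (s / t) (2 / t)) ^+ 2.
  by rewrite acE expg2 (sl2M detR detR); congr sl2; rewrite /s; field.
have acn : (a * c) ^+ nonsplit_half_order = 1.
  rewrite acR -expgM; apply: sl2_order_nonsquare => //.
  by have -> : ((2 + s) / t + 2 / t = t)%R by rewrite /s; field.
exists a, c; split.
- by rewrite expgM sl2_upper_exp pF0 sl2_1 expg1n.
- by rewrite expgM sl2_lower_exp pF0 sl2_1 expg1n.
- by rewrite mulnC expgM acn expg1n.
apply/eqP; rewrite eqEsubset gen_subG; apply/andP; split.
  by apply/subsetP=> g /set2P[] ->; rewrite KE sl2_in.
rewrite KE; apply: (sl2_sub_gen (oner_neq0 F) s0 detL).
  by rewrite mem_gen // !inE eqxx.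
by rewrite mem_gen // !inE eqxx orbT.
Qed.

(** The traces 5, 6, 6 give 4 - t^2 = 1 modulo 11; moreover a^6 = -1 and a^2 c is a transvection. *)
Lemma even_pair_11 (K : {group {'GL_2[F]}}) : K :=: sl2_set -> p = 11 -> even_pair_for K.
Proof.
move=> KE p11; have mod11 (k x y : F) : (x = y + 11 * k -> x = y)%R by rewrite -p11; apply: modp.
have deta : (0 * 5 - 1 * -1 = 1 :> F)%R by ring.
have detc : (2 * 4 - 8 * 5 = 1 :> F)%R by apply: (mod11 (-3)%R); ring.
pose a := sl2 0 1 (-1) 5; pose c := sl2 2 8 5 4.
have a2E : a * a = sl2 (-1) 5 (-5) 2.
  by rewrite (sl2M deta deta); congr sl2; [ring | ring | ring | apply: (mod11 2%R); ring].
have deta2 : (-1 * 2 - 5 * -5 = 1 :> F)%R by apply: (mod11 2%R); ring.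
have a3E : a * a * a = sl2 (-5) 2 (-2) 5.
  by rewrite a2E (sl2M deta2 deta); congr sl2; [| apply: (mod11 2%R) | | ]; ring.
have deta3 : (-5 * 5 - 2 * -2 = 1 :> F)%R by apply: (mod11 (-2)%R); ring.
have acE : a * c = sl2 5 4 1 1.
  by rewrite (sl2M deta detc); congr sl2; [| | apply: (mod11 2%R) | apply: (mod11 1%R)]; ring.
have aJ : a ^+ 6 = J.
  have a3 : a ^+ 3 = a * a * a by rewrite !expgS expg0 mulg1 mulgA.
  rewrite (expgM a 3 2) a3 a3E expg2 (sl2M deta3 deta3).
  by congr sl2; [apply: (mod11 2%R) | | | apply: (mod11 2%R)]; ring.
have a2cE : a * a * c = sl2 1 1 0 1.
  rewrite a2E (sl2M deta2 detc).
  by congr sl2; [apply: (mod11 2%R) | apply: (mod11 1%R) | | apply: (mod11 (-3)%R)]; ring.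
have split_of (x y z w : F) : (x * w - y * z = 1)%R ->
    (4 - (x + w) ^+ 2 = 1)%R -> is_split (sl2 x y z w).
  by move=> det1 E; apply: sl2_is_split => //; rewrite E expr1n.
have split_a : is_split a by apply: split_of => //; apply: (mod11 (-2)%R); ring.
have split_c : is_split c by apply: split_of => //; apply: (mod11 (-3)%R); ring.
have split_ac : is_split (a * c).
  by rewrite acE; apply: split_of; [ring | apply: (mod11 (-3)%R); ring].
apply: (split_pair KE split_a split_c split_ac aJ (oner_neq0 F) _ _ detc (erefl c)).
  by rewrite -a2cE !groupM // mem_gen // !inE eqxx ?orbT.
by apply: natr_neq0; rewrite // p11.
Qed.

(** The traces 4, 4, -4 give 4 - t^2 = 1 modulo 13; moreover a^6 = -1 and a^3 c is a
    transvection. *)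
Lemma even_pair_13 (K : {group {'GL_2[F]}}) : K :=: sl2_set -> p = 13 -> even_pair_for K.
Proof.
move=> KE p13; have mod13 (k x y : F) : (x = y + 13 * k -> x = y)%R by rewrite -p13; apply: modp.
have two0 : (2 != 0 :> F)%R by [].
have deta : (0 * 4 - 1 * -1 = 1 :> F)%R by ring.
have detc : (4 * 0 - 6 * 2 = 1 :> F)%R by apply: (mod13 (-1)%R); ring.
pose a := sl2 0 1 (-1) 4; pose c := sl2 4 6 2 0.
have a2E : a * a = sl2 (-1) 4 (-4) 2.
  by rewrite (sl2M deta deta); congr sl2; [ring | ring | ring | apply: (mod13 1%R); ring].
have deta2 : (-1 * 2 - 4 * -4 = 1 :> F)%R by apply: (mod13 1%R); ring.
have a3E : a * a * a = sl2 (-4) 2 (-2) 4.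
  by rewrite a2E (sl2M deta2 deta); congr sl2; [| apply: (mod13 1%R) | | ]; ring.
have deta3 : (-4 * 4 - 2 * -2 = 1 :> F)%R by apply: (mod13 (-1)%R); ring.
have acE : a * c = sl2 2 0 4 (-6).
  by rewrite (sl2M deta detc); congr sl2; ring.
have aJ : a ^+ 6 = J.
  have a3 : a ^+ 3 = a * a * a by rewrite !expgS expg0 mulg1 mulgA.
  rewrite (expgM a 3 2) a3 a3E expg2 (sl2M deta3 deta3).
  by congr sl2; [apply: (mod13 1%R) | | | apply: (mod13 1%R)]; ring.
have a3cE : a * a * a * c = sl2 1 2 0 1.
  rewrite a3E (sl2M deta3 detc).
  by congr sl2; [apply: (mod13 (-1)%R) | apply: (mod13 (-2)%R) | | apply: (mod13 (-1)%R)]; ring.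
have split_of (x y z w : F) : (x * w - y * z = 1)%R ->
    (4 - (x + w) ^+ 2 = 1)%R -> is_split (sl2 x y z w).
  by move=> det1 E; apply: sl2_is_split => //; rewrite E expr1n.
have split_a : is_split a by apply: split_of => //; apply: (mod13 (-1)%R); ring.
have split_c : is_split c by apply: split_of => //; apply: (mod13 (-1)%R); ring.
have split_ac : is_split (a * c).
  by rewrite acE; apply: split_of; apply: (mod13 (-1)%R); ring.
apply: (split_pair KE split_a split_c split_ac aJ two0 _ two0 detc (erefl c)).
by rewrite -a3cE !groupM // mem_gen // !inE eqxx ?orbT.
Qed.

Lemma sl2_even_pair (K : {group {'GL_2[F]}}) : K :=: sl2_set ->
  p \notin [:: 3; 5; 17] -> even_pair_for K.
Proof.
move=> KE; rewrite !inE !negb_or => /and3P[p3 p5 p17].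
have [p7|p7] := eqVneq p 7; first exact: even_pair_7.
have [p11|p11] := eqVneq p 11; first exact: even_pair_11.
have [p13|p13] := eqVneq p 13; first exact: even_pair_13.
have [p4|p4] : (p %% 4 = 1)%N \/ (p %% 4 = 3)%N.
  by have := divn_eq p 4; have := ltn_mod p 4; have := p_half; clear; lia.
- by apply: even_pair_mod4_1; rewrite // !inE !negb_or p5 p13.
- by apply: even_pair_mod4_3; rewrite // !inE !negb_or p3 p7.
Qed.

(** Let M = (p + eps)/2, which is odd. Then p - eps = 2(M - eps), where M - eps and M are
    consecutive. *)
Lemma coprime_orders : coprime split_order (p * nonsplit_half_order).
Proof.
have p1 := prime_gt1 p_pr; have pE := p_half; have := divn_eq p 4.
have : (p %% 4 < 4)%N by rewrite ltn_mod.
rewrite /split_order /nonsplit_half_order coprimeMr.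
case: ifP => [/eqP p4|p4] lt4 pE4.
  have [m mE] : exists m, p./2 = (2 * m)%N by exists (p %/ 4); lia.
  have -> : p.+1./2 = (2 * m).+1 by lia.
  rewrite coprimePn ?prime_gt0 //; have -> : p.-1 = (2 * (2 * m))%N by lia.
  by rewrite coprimeMl coprime2n /= oddM coprimenS.
have [m mE] : exists m, p./2 = (2 * m).+1 by exists (p %/ 4); lia.
have -> : p.-1./2 = (2 * m).+1 by lia.
rewrite coprimeSn; have -> : p.+1 = (2 * (2 * m).+2)%N by lia.
by rewrite coprimeMl coprime2n /= oddM coprimeSn.
Qed.

End SpecialLinear.

Lemma SL2_mixed_beauville p : prime p -> p \notin [:: 2; 3; 5; 17] ->
  admits_mixed_beauville (H4 (SL2_group p)).
Proof.
move=> p_pr; rewrite inE negb_or => /andP[p2 pn].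
have p_odd : odd p by case/even_prime: p_pr p2 => [->|].
have charF : (p \in [pchar 'F_p])%R := pchar_Fp p_pr.
have cardF : #|'F_p| = p := card_Fp p_pr.
have natF (x : 'F_p) : exists n : nat, (n%:R = x)%R by exists x; rewrite natr_Zp.
have KE : SL2_group p :=: sl2_set 'F_p by [].
have [a1 [c1 [[even_a even_c] a1n c1n ac1n gen1]]] :=
  sl2_even_pair p_pr p_odd charF cardF natF KE pn.
have p3 : p != 3 by move: pn; rewrite !inE !negb_or => /and3P[].
have [a2 [c2 [a2n c2n ac2n gen2]]] := sl2_odd_pair p_pr p_odd charF cardF natF KE p3.
have genodd : SL2_group p \subset <<[set g in SL2_group p | odd #[g]]>>.
  exact: (sl2_gen_odd_order p_odd charF natF).
exact: (H4_mixed_beauville (coprime_orders p_pr p_odd charF cardF) even_a even_c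
  (And3 a1n c1n ac1n) (And3 a2n c2n ac2n) gen1 gen2 genodd).
Qed.

Theorem proposition4p6 :
  (exists N : nat, forall n : nat, (N <= n)%N ->
     admits_mixed_beauville (H4 'Alt_('I_n))) /\
  (forall p : nat, prime p -> p \notin [:: 2; 3; 5; 17] ->
     admits_mixed_beauville (H4 (SL2_group p))).
Proof.
split; last exact: SL2_mixed_beauville.
by exists 100; exact: Alt_large_mixed_beauville.
Qed.
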